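(* The system $\mathsf{ACA}_0^\omega+\Delta\text{-}\mathsf{CA}$ proves the implication $\mathsf{ALCL}\rightarrow\mathsf{BOOT}$, where $\mathsf{ALCL}$ is the statement: every field over Baire space is isomorphic to a sub-field of an algebraically closed field over Baire space; and $\mathsf{BOOT}$ is the statement $(\forall Y^{2})(\exists X^{1})(\forall n^{0})\big[ n\in X \leftrightarrow (\exists f^{1})(Y(f, n)=0)\big]$.
   Context: Finite types: $0$ is a type (natural numbers), and if $\sigma,\tau$ are types, so is $\sigma\to\tau$; $1\equiv 0\to 0$ and $n+1\equiv n\to 0$. Superscripts indicate types. Type $1$ objects are elements of $\mathbb{N}^{\mathbb{N}}$, type $2$ objects are functionals $\mathbb{N}^{\mathbb{N}}\to\mathbb{N}$. Pairs and finite sequences are coded as usual (finite sequences of type $1$ objects as type $1$ objects). $\mathsf{L}_\omega$ is the language with variables of every finite type, constants $0,1,<_0,+_0,\times_0,=_0$, the combinators $\Pi,\Sigma$ and the recursor $\mathbf{R}_0$. For $\tau=(\tau_1\to\dots\to\tau_k\to 0)$, $x=_\tau y$ means $(\forall z_1^{\tau_1}\dots z_k^{\tau_k})(xz_1\dots z_k=_0 yz_1\dots z_k)$. The system $\mathsf{RCA}_0^\omega$ has the axioms: (a) $0,1,<_0,+_0,\times_0$ form an ordered semi-ring with equality $=_0$; (b) the defining axioms of the combinators $\Pi,\Sigma$ (giving $\lambda$-abstraction); (c) $\mathbf{R}_0(f^1,m^0,0)=m$ and $\mathbf{R}_0(f,m,n+1)=f(n,\mathbf{R}_0(f,m,n))$;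 (d) extensionality: $(\forall x^\rho,y^\rho,\varphi^{\rho\to\tau})(x=_\rho y\to\varphi(x)=_\tau\varphi(y))$ for all types $\rho,\tau$; (e) induction for quantifier-free formulas of $\mathsf{L}_\omega$; (f) $\mathsf{QF}\text{-}\mathsf{AC}^{1,0}$, where $\mathsf{QF}\text{-}\mathsf{AC}^{\sigma,\tau}$ is $(\forall x^\sigma)(\exists y^\tau)A(x,y)\to(\exists Y^{\sigma\to\tau})(\forall x^\sigma)A(x,Y(x))$ for quantifier-free $A$ of $\mathsf{L}_\omega$. $\mathsf{ACA}_0^\omega$ is $\mathsf{RCA}_0^\omega+(\mu^2)$, where $(\mu^2)$ is $(\exists\mu^2)(\forall f^1)\big[(\exists n)(f(n)=0)\to[f(\mu(f))=0\wedge(\forall i<\mu(f))f(i)\neq0]\wedge[(\forall n)(f(n)\neq 0)\to\mu(f)=0]\big]$. $\Delta\text{-}\mathsf{CA}$ is: $(\forall Y^2,Z^2)\big[(\forall n^0)\big((\exists f^1)(Y(f,n)=0)\leftrightarrow(\forall g^1)(Z(g,n)=0)\big)\to(\exists X^1)(\forall n^0)(n\in X\leftrightarrow(\exists f^1)(Y(f,n)=0))\big]$. Sets are given by characteristic functions: $X\subseteq\mathbb{N}$ is a type $1$ object, a subset of $\mathbb{N}^{\mathbb{N}}$ (in particular a field's domain or a sub-field) is given by a type $2$ functional, and a binary relation on it by a functional of type $(1\times1)\to0$. A field $K$ over Baire space consists of a set $|K|\subseteq\mathbb{N}^{\mathbb{N}}$ with distinguished elements $0_K,1_K$, an equivalence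 relation $=_K$, and operations $+_K,-_K,\times_K$ on $|K|$ satisfying the usual field axioms (with $=_K$ as equality). Polynomial rings and algebraically closed fields are defined in the conventional way. *)

(* Defs.v *)
(* Higher-order arithmetic, deeply embedded: typed combinatory terms, many-sorted classical first-order formulas, and natural deduction. *)
From Stdlib Require Import List.

(** * Finite types and the language L_omega *)

Inductive ty : Type :=
| N0 : ty
| Arr : ty -> ty -> ty.

Declare Scope ty_scope.
Delimit Scope ty_scope with ty.
Bind Scope ty_scope with ty.
Notation "s ~> t" := (Arr s t) (at level 55, right associativity) : ty_scope.

Definition N1 : ty := (N0 ~> N0)%ty.
Definition N2 : ty := (N1 ~> N0)%ty.

Definition ty_dec (s t : ty) : {s = t} + {s <> t}.
Proof. decide equality. Defined.

(* Functions of several arguments are curried, in particular the first argument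
   of the recursor [Rec] and binary relations on type 1.
   [Var t n] is the de Bruijn variable of index [n] among the variables of
   type [t]: a binder of type [t] only affects the indices at type [t]. *)
Inductive tm : ty -> Type :=
| Var (t : ty) (n : nat) : tm t
| Zero : tm N0
| One : tm N0
| Plus : tm (N0 ~> N0 ~> N0)
| Times : tm (N0 ~> N0 ~> N0)
| Pi (s t : ty) : tm (s ~> t ~> s)
| Sigma (r s t : ty) : tm ((r ~> s ~> t) ~> (r ~> s) ~> r ~> t)
| Rec : tm ((N0 ~> N0 ~> N0) ~> N0 ~> N0 ~> N0)
| App (s t : ty) (f : tm (s ~> t)) (x : tm s) : tm t.
Arguments App {s t} f x.

(* The prime formulas are equations and inequalities between terms of type 0;
   equality at higher types is an abbreviation ([beq] below). *)
Inductive fm : Type :=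
| Bot : fm
| Eq0 (a b : tm N0) : fm
| Lt0 (a b : tm N0) : fm
| Imp (A B : fm) : fm
| All (t : ty) (A : fm) : fm.

Definition Neg (A : fm) : fm := Imp A Bot.
Definition And (A B : fm) : fm := Neg (Imp A (Neg B)).
Definition Or (A B : fm) : fm := Imp (Neg A) B.
Definition Ex (t : ty) (A : fm) : fm := Neg (All t (Neg A)).

Fixpoint qf (A : fm) : Prop :=
  match A with
  | Imp A B => qf A /\ qf B
  | All _ _ => False
  | _ => True
  end.

(** * Substitution and derivability *)

Definition sub : Type := forall t : ty, nat -> tm t.

Fixpoint tsub (s : sub) {t : ty} (u : tm t) : tm t :=
  match u in tm t return tm t with
  | Var t n => s t n
  | Zero => Zero
  | One => One
  | Plus => Plus
  | Times => Times
  | Pi a b => Pi a b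
  | Sigma a b c => Sigma a b c
  | Rec => Rec
  | App f x => App (tsub s f) (tsub s x)
  end.

Definition shift (t : ty) : sub :=
  fun r n => if ty_dec t r then Var r (S n) else Var r n.

Definition scons {t : ty} (u : tm t) (s : sub) : sub :=
  fun r =>
    match ty_dec t r with
    | left e => fun n => match n with
                         | O => eq_rect t tm u r e
                         | S m => s r m
                         end
    | right _ => s r
    end.

Definition up (t : ty) (s : sub) : sub :=
  scons (Var t 0) (fun r n => tsub (shift t) (s r n)).

Fixpoint fsub (s : sub) (A : fm) : fm :=
  match A with
  | Bot => Bot
  | Eq0 a b => Eq0 (tsub s a) (tsub s b)
  | Lt0 a b => Lt0 (tsub s a) (tsub s b)
  | Imp A B => Imp (fsub s A) (fsub s B)
  | All t A => All t (fsub (up t s) A)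
  end.

(* Classical natural deduction.  Members of [T] are available in every context,
   also below [prv_all_i]: an axiom with free variables therefore stands for its
   universal closure. *)
Inductive prv (T : fm -> Prop) : list fm -> fm -> Prop :=
| prv_ax G A : T A -> prv T G A
| prv_hyp G A : In A G -> prv T G A
| prv_imp_i G A B : prv T (A :: G) B -> prv T G (Imp A B)
| prv_imp_e G A B : prv T G (Imp A B) -> prv T G A -> prv T G B
| prv_all_i G t A : prv T (map (fsub (shift t)) G) A -> prv T G (All t A)
| prv_all_e G t A (u : tm t) : prv T G (All t A) -> prv T G (fsub (scons u Var) A)
| prv_dne G A : prv T G (Neg (Neg A)) -> prv T G A.

Definition proves (T : fm -> Prop) (A : fm) : Prop := prv T nil A.

(** * Writing formulas with named bound variables *)

(* A [Tm t] or [Fm] is a term or formula as a function of its binding depth,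
   i.e. of the number of enclosing binders at each type.  A binder introduced at
   depth [d] hands its body the variable of level [d t], whose index at a later
   depth [d'] is [d' t - S (d t)]. *)
Definition depth : Type := ty -> nat.
Definition Tm (t : ty) : Type := depth -> tm t.
Definition Fm : Type := depth -> fm.

Definition deeper (t : ty) (d : depth) : depth :=
  fun r => if ty_dec t r then S (d r) else d r.

Definition ball (t : ty) (F : Tm t -> Fm) : Fm :=
  fun d => All t (F (fun d' => Var t (d' t - S (d t))) (deeper t d)).
Definition bex (t : ty) (F : Tm t -> Fm) : Fm :=
  fun d => Ex t (F (fun d' => Var t (d' t - S (d t))) (deeper t d)).
Definition sentence (A : Fm) : fm := A (fun _ => 0).

Definition cst {t : ty} (c : tm t) : Tm t := fun _ => c.
Definition bapp {s t : ty} (f : Tm (s ~> t)) (x : Tm s) : Tm t :=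
  fun d => App (f d) (x d).
Definition beq0 (a b : Tm N0) : Fm := fun d => Eq0 (a d) (b d).
Definition blt0 (a b : Tm N0) : Fm := fun d => Lt0 (a d) (b d).
Definition bneg (A : Fm) : Fm := fun d => Neg (A d).
Definition bimp (A B : Fm) : Fm := fun d => Imp (A d) (B d).
Definition band (A B : Fm) : Fm := fun d => And (A d) (B d).
Definition bor (A B : Fm) : Fm := fun d => Or (A d) (B d).
Definition biff (A B : Fm) : Fm := band (bimp A B) (bimp B A).

Declare Scope hoa_scope.
Delimit Scope hoa_scope with hoa.
Bind Scope hoa_scope with Tm.
Bind Scope hoa_scope with Fm.

Notation "f @ x" := (bapp f x) (at level 36, left associativity) : hoa_scope.
Notation "0" := (cst Zero) : hoa_scope.
Notation "1" := (cst One) : hoa_scope.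
Notation "a + b" := (cst Plus @ a @ b)%hoa : hoa_scope.
Notation "a * b" := (cst Times @ a @ b)%hoa : hoa_scope.
Notation "a == b" := (beq0 a b) (at level 70, no associativity) : hoa_scope.
Notation "a < b" := (blt0 a b) : hoa_scope.
Notation "~ A" := (bneg A) : hoa_scope.
Notation "A /\ B" := (band A B) : hoa_scope.
Notation "A \/ B" := (bor A B) : hoa_scope.
Notation "A ==> B" := (bimp A B) (at level 90, right associativity) : hoa_scope.
Notation "A <==> B" := (biff A B) (at level 95, no associativity) : hoa_scope.
Notation "'all' x : t , A" := (ball t (fun x => A%hoa))
  (at level 200, x name, t at level 60, A at level 200) : hoa_scope.
Notation "'ex' x : t , A" := (bex t (fun x => A%hoa))
  (at level 200, x name, t at level 60, A at level 200) : hoa_scope.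

Local Open Scope hoa_scope.

Fixpoint beq (t : ty) : Tm t -> Tm t -> Fm :=
  match t with
  | N0 => beq0
  | Arr r s => fun x y => all z : r, beq s (x @ z) (y @ z)
  end.

(** * The systems *)

Inductive ordered_semiring : Fm -> Prop :=
| osr_eq_refl : ordered_semiring (all x : N0, x == x)
| osr_eq_sym : ordered_semiring (all x : N0, all y : N0, x == y ==> y == x)
| osr_eq_trans : ordered_semiring
    (all x : N0, all y : N0, all z : N0, x == y ==> y == z ==> x == z)
| osr_eq_add : ordered_semiring
    (all x : N0, all y : N0, all u : N0, all v : N0,
       x == y ==> u == v ==> x + u == y + v)
| osr_eq_mul : ordered_semiring
    (all x : N0, all y : N0, all u : N0, all v : N0,
       x == y ==> u == v ==> x * u == y * v)
| osr_eq_lt : ordered_semiring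
    (all x : N0, all y : N0, all u : N0, all v : N0,
       x == y ==> u == v ==> x < u ==> y < v)
| osr_addA : ordered_semiring
    (all x : N0, all y : N0, all z : N0, x + (y + z) == (x + y) + z)
| osr_addC : ordered_semiring (all x : N0, all y : N0, x + y == y + x)
| osr_add0 : ordered_semiring (all x : N0, x + 0 == x)
| osr_mulA : ordered_semiring
    (all x : N0, all y : N0, all z : N0, x * (y * z) == (x * y) * z)
| osr_mulC : ordered_semiring (all x : N0, all y : N0, x * y == y * x)
| osr_mul1 : ordered_semiring (all x : N0, x * 1 == x)
| osr_mul0 : ordered_semiring (all x : N0, x * 0 == 0)
| osr_mulD : ordered_semiring
    (all x : N0, all y : N0, all z : N0, x * (y + z) == x * y + x * z)
| osr_lt_irrefl : ordered_semiring (all x : N0, ~ (x < x))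
| osr_lt_trans : ordered_semiring
    (all x : N0, all y : N0, all z : N0, x < y ==> y < z ==> x < z)
| osr_lt_total : ordered_semiring
    (all x : N0, all y : N0, x < y \/ x == y \/ y < x)
| osr_lt01 : ordered_semiring (0 < 1)
| osr_lt_add : ordered_semiring
    (all x : N0, all y : N0, all z : N0, x < y ==> x + z < y + z)
| osr_lt_mul : ordered_semiring
    (all x : N0, all y : N0, all z : N0, x < y ==> 0 < z ==> x * z < y * z).

(* In [A] the induction variable is [Var N0 0]; all other variables are
   parameters. *)
Definition induction (A : fm) : fm :=
  Imp (fsub (scons Zero Var) A)
    (Imp (All N0 (Imp A
            (fsub (scons (App (App Plus (Var N0 0)) One) (shift N0)) A)))
       (All N0 A)).

(* In [A] the variables x^1 and y^0 are [Var N1 0] and [Var N0 0].  The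
   conclusion replaces y by Y(x) and shifts the parameters of type 2 past the
   new quantifier over Y. *)
Definition ac10 (A : fm) : fm :=
  Imp (All N1 (Ex N0 A))
    (Ex N2 (All N1 (fsub (scons (App (Var N2 0) (Var N1 0)) (shift N2)) A))).

Inductive RCA0w : fm -> Prop :=
| rca_semiring A : ordered_semiring A -> RCA0w (sentence A)
| rca_Pi (s t : ty) : RCA0w (sentence
    (all x : s, all y : t, beq s (cst (Pi s t) @ x @ y) x))
| rca_Sigma (r s t : ty) : RCA0w (sentence
    (all x : (r ~> s ~> t)%ty, all y : (r ~> s)%ty, all z : r,
       beq t (cst (Sigma r s t) @ x @ y @ z) (x @ z @ (y @ z))))
| rca_Rec0 : RCA0w (sentence
    (all f : (N0 ~> N0 ~> N0)%ty, all m : N0, cst Rec @ f @ m @ 0 == m))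
| rca_RecS : RCA0w (sentence
    (all f : (N0 ~> N0 ~> N0)%ty, all m : N0, all n : N0,
       cst Rec @ f @ m @ (n + 1) == f @ n @ (cst Rec @ f @ m @ n)))
| rca_ext (r t : ty) : RCA0w (sentence
    (all x : r, all y : r, all phi : (r ~> t)%ty,
       beq r x y ==> beq t (phi @ x) (phi @ y)))
| rca_ind A : qf A -> RCA0w (induction A)
| rca_ac A : qf A -> RCA0w (ac10 A).

Definition mu2 : Fm :=
  ex mu : N2, all f : N1,
    ((ex n : N0, f @ n == 0) ==>
       f @ (mu @ f) == 0 /\ (all i : N0, i < mu @ f ==> ~ (f @ i == 0)))
    /\ ((all n : N0, ~ (f @ n == 0)) ==> mu @ f == 0).

Definition ACA0w (A : fm) : Prop := RCA0w A \/ A = sentence mu2.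

(** * Sets, Delta-comprehension and bootstrap *)

(* A set is a {0,1}-valued object; membership means value 1. *)
Definition is_set (t : ty) (X : Tm (t ~> N0)) : Fm :=
  all x : t, X @ x == 0 \/ X @ x == 1.
Definition mem {t : ty} (x : Tm t) (X : Tm (t ~> N0)) : Fm := X @ x == 1.

(* The pair (f, n) as a type 1 object: the sequence n, f(0), f(1), ...  Here
   [Sigma (Pi Pi) f] is the function taking a, b to f(a). *)
Definition pair10 (f : Tm N1) (n : Tm N0) : Tm N1 :=
  cst Rec
    @ (cst (Sigma N0 N0 (N0 ~> N0))
         @ (cst (Pi (N0 ~> N0 ~> N0) N0) @ cst (Pi N0 N0)) @ f)
    @ n.

Definition DeltaCA : Fm :=
  all Y : N2, all Z : N2,
    (all n : N0, (ex f : N1, Y @ pair10 f n == 0)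
                   <==> (all g : N1, Z @ pair10 g n == 0)) ==>
    ex X : N1, is_set N0 X /\
      all n : N0, mem n X <==> ex f : N1, Y @ pair10 f n == 0.

Definition BOOT : Fm :=
  all Y : N2, ex X : N1, is_set N0 X /\
    all n : N0, mem n X <==> ex f : N1, Y @ pair10 f n == 0.

Definition ACA0w_DeltaCA (A : fm) : Prop := ACA0w A \/ A = sentence DeltaCA.

(** * Fields over Baire space *)

Record field_data : Type := FieldData {
  fdom : Tm N2;
  fzero : Tm N1;
  fone : Tm N1;
  feqv : Tm (N1 ~> N1 ~> N0);
  fadd : Tm (N1 ~> N1 ~> N1);
  fopp : Tm (N1 ~> N1);
  fmul : Tm (N1 ~> N1 ~> N1)
}.

Definition all_field (F : field_data -> Fm) : Fm :=
  all D : N2, all z : N1, all o : N1, all e : (N1 ~> N1 ~> N0)%ty,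
  all a : (N1 ~> N1 ~> N1)%ty, all n : (N1 ~> N1)%ty,
  all m : (N1 ~> N1 ~> N1)%ty, F (FieldData D z o e a n m).
Definition ex_field (F : field_data -> Fm) : Fm :=
  ex D : N2, ex z : N1, ex o : N1, ex e : (N1 ~> N1 ~> N0)%ty,
  ex a : (N1 ~> N1 ~> N1)%ty, ex n : (N1 ~> N1)%ty,
  ex m : (N1 ~> N1 ~> N1)%ty, F (FieldData D z o e a n m).

Definition all_in (X : Tm N2) (F : Tm N1 -> Fm) : Fm :=
  all x : N1, mem x X ==> F x.
Definition ex_in (X : Tm N2) (F : Tm N1 -> Fm) : Fm :=
  ex x : N1, mem x X /\ F x.
Notation "'all' x 'in' X , A" := (all_in X (fun x => A%hoa))
  (at level 200, x name, X at level 60, A at level 200) : hoa_scope.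
Notation "'ex' x 'in' X , A" := (ex_in X (fun x => A%hoa))
  (at level 200, x name, X at level 60, A at level 200) : hoa_scope.

Section FieldFormulas.
Variable K : field_data.
Let D := fdom K.
Let zero := fzero K.
Let one := fone K.
Let eqv (x y : Tm N1) : Fm := feqv K @ x @ y == 1.
Let add (x y : Tm N1) : Tm N1 := fadd K @ x @ y.
Let opp (x : Tm N1) : Tm N1 := fopp K @ x.
Let mul (x y : Tm N1) : Tm N1 := fmul K @ x @ y.

Definition is_equivalence : Fm :=
  (all x in D, all y in D, feqv K @ x @ y == 0 \/ feqv K @ x @ y == 1)
  /\ (all x in D, eqv x x)
  /\ (all x in D, all y in D, eqv x y ==> eqv y x)
  /\ (all x in D, all y in D, all z in D, eqv x y ==> eqv y z ==> eqv x z).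

Definition is_closed : Fm :=
  mem zero D /\ mem one D
  /\ (all x in D, all y in D, mem (add x y) D)
  /\ (all x in D, mem (opp x) D)
  /\ (all x in D, all y in D, mem (mul x y) D).

Definition is_congruence : Fm :=
  (all x in D, all y in D, all u in D, all v in D,
     eqv x y ==> eqv u v ==> eqv (add x u) (add y v))
  /\ (all x in D, all y in D, eqv x y ==> eqv (opp x) (opp y))
  /\ (all x in D, all y in D, all u in D, all v in D,
        eqv x y ==> eqv u v ==> eqv (mul x u) (mul y v)).

Definition field_axioms : Fm :=
  (all x in D, all y in D, all z in D,
     eqv (add x (add y z)) (add (add x y) z))
  /\ (all x in D, all y in D, eqv (add x y) (add y x))
  /\ (all x in D, eqv (add x zero) x)
  /\ (all x in D, eqv (add x (opp x)) zero)
  /\ (all x in D, all y in D, all z in D,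
        eqv (mul x (mul y z)) (mul (mul x y) z))
  /\ (all x in D, all y in D, eqv (mul x y) (mul y x))
  /\ (all x in D, eqv (mul x one) x)
  /\ (all x in D, all y in D, all z in D,
        eqv (mul x (add y z)) (add (mul x y) (mul x z)))
  /\ ~ eqv zero one
  /\ (all x in D, ~ eqv x zero ==> ex y in D, eqv (mul x y) one).

Definition is_field : Fm :=
  is_set N1 D /\ is_equivalence /\ is_closed /\ is_congruence /\ field_axioms.

(* A finite sequence of type 1 objects is a functional of type 0 -> 1 together
   with a length.  p(0) + p(1) X + ... + p(n) X^n is a polynomial over K of degree n. *)
Definition is_poly (p : Tm (N0 ~> N1)) (n : Tm N0) : Fm :=
  (all i : N0, i < n + 1 ==> mem (p @ i) D) /\ ~ eqv (p @ n) zero.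

(* The value at x of this polynomial is y: q lists the powers of x and s the
   partial sums. *)
Definition poly_value (p : Tm (N0 ~> N1)) (n : Tm N0) (x y : Tm N1) : Fm :=
  ex q : (N0 ~> N1)%ty, ex s : (N0 ~> N1)%ty,
    (all i : N0, i < n + 1 ==> mem (q @ i) D /\ mem (s @ i) D)
    /\ eqv (q @ 0) one
    /\ (all i : N0, i < n ==> eqv (q @ (i + 1)) (mul (q @ i) x))
    /\ eqv (s @ 0) (mul (p @ 0) (q @ 0))
    /\ (all i : N0, i < n ==>
          eqv (s @ (i + 1)) (add (s @ i) (mul (p @ (i + 1)) (q @ (i + 1)))))
    /\ eqv (s @ n) y.

Definition is_alg_closed : Fm :=
  all p : (N0 ~> N1)%ty, all n : N0,
    0 < n ==> is_poly p n ==> ex x in D, poly_value p n x zero.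

Definition restrict (S : Tm N2) : field_data :=
  FieldData S zero one (feqv K) (fadd K) (fopp K) (fmul K).

End FieldFormulas.

(* The equality of K being its equivalence relation, a subset of K is closed
   under that relation. *)
Definition is_subfield (K : field_data) (S : Tm N2) : Fm :=
  (all x in S, mem x (fdom K))
  /\ (all x in S, all y in fdom K, feqv K @ x @ y == 1 ==> mem y S)
  /\ is_field (restrict K S).

Definition is_iso (K M : field_data) (h : Tm (N1 ~> N1)) : Fm :=
  (all x in fdom K, mem (h @ x) (fdom M))
  /\ (all x in fdom K, all y in fdom K,
        feqv K @ x @ y == 1 <==> feqv M @ (h @ x) @ (h @ y) == 1)
  /\ (all y in fdom M, ex x in fdom K, feqv M @ (h @ x) @ y == 1)
  /\ feqv M @ (h @ fzero K) @ fzero M == 1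
  /\ feqv M @ (h @ fone K) @ fone M == 1
  /\ (all x in fdom K, all y in fdom K,
        feqv M @ (h @ (fadd K @ x @ y)) @ (fadd M @ (h @ x) @ (h @ y)) == 1)
  /\ (all x in fdom K,
        feqv M @ (h @ (fopp K @ x)) @ (fopp M @ (h @ x)) == 1)
  /\ (all x in fdom K, all y in fdom K,
        feqv M @ (h @ (fmul K @ x @ y)) @ (fmul M @ (h @ x) @ (h @ y)) == 1).

Definition ALCL : Fm :=
  all_field (fun K => is_field K ==>
    ex_field (fun L => is_field L /\ is_alg_closed L /\
      ex S : N2, is_subfield L S /\
        ex h : (N1 ~> N1)%ty, is_iso K (restrict L S) h)).

(* Main.v *)
From Stdlib Require Import List Arith Lia Cantor Classical ClassicalEpsilon
  FunctionalExtensionality PropExtensionality ProofIrrelevance Eqdep_dec Ring.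
Require Import Defs.

(* By Henkin's completeness theorem it is enough to argue in an extensional model
   of the system.  There, let R be the ring of functions from the (possibly
   nonstandard) numbers to F_2 under Dirichlet convolution: the power series over
   F_2 in infinitely many variables, a positive integer standing for a monomial.
   R is a domain because the least index of the support is multiplicative.  Let
   x_n be the indicator of Q_n, where Q_0, Q_1, ... are the pairwise coprime
   numbers with Q_n = 1 + Q_0 ... Q_(n-1).  Given Y, let K consist of the fractions
   a/b of R together with a sequence w such that, for every n, either
   Y(w(n), n) = 0 or the exponent of Q_n is even on the supports of a and b.
   Then K is a field, equality being that of the fractions, it contains all the
   squares x_n^2, and x_n^2 has a square root in K iff Y(f, n) = 0 for some f.
   If K is isomorphic to a subfield S of an algebraically closed field, the
   image of x_n^2 has square roots r and -r, so "some root is in S" and "all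
   roots are in S" are equivalent, and Delta-comprehension applies. *)

(** The obstacle is that the domain of a field needs a characteristic functional, while [mu] decides
    only quantifiers over numbers. The fractions whose supports are even in Q_n whenever Y(f, n) = 0
    has no solution f would be the natural choice, but that condition quantifies over functions.
    Hence an element brings its own witnesses along, and membership becomes arithmetical. Two
    elements with different witnesses can be equal, so the set of fractions that occur is still
    undecided; it is the set S, decidable and closed under the equality of the larger field, that
    decides it. The ring is chosen to avoid coding. Power series need no finiteness condition, and
    Dirichlet convolution turns products of monomials into products of numbers, so that all
    operations are bounded sums, meaningful also at nonstandard indices. Over F_2 there are no
    signs, and a^2 + x_n^2 b^2 is the square of a + x_n b. The recursion for Q_n yields coprimality
    by a direct computation, so no theory of primes or of unique factorization is developed. *)

Lemma ty_dec_refl (t : ty) : ty_dec t t = left eq_refl.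
Proof.
  destruct (ty_dec t t) as [e|n]; [|now destruct n].
  now rewrite (UIP_dec ty_dec e eq_refl).
Qed.

(** * The calculus of substitutions *)

Definition scomp (s s' : sub) : sub := fun r n => tsub s (s' r n).

Lemma tsub_tsub (s s' : sub) (t : ty) (u : tm t) :
  tsub s (tsub s' u) = tsub (scomp s s') u.
Proof. induction u; simpl; rewrite ?IHu1, ?IHu2; reflexivity. Qed.

Lemma tsub_Var (t : ty) (u : tm t) : tsub Var u = u.
Proof. induction u; simpl; rewrite ?IHu1, ?IHu2; reflexivity. Qed.

Lemma scompA (s1 s2 s3 : sub) : scomp s1 (scomp s2 s3) = scomp (scomp s1 s2) s3.
Proof. extensionality r; extensionality n; apply tsub_tsub. Qed.

Lemma scons0 (t : ty) (u : tm t) (s : sub) : scons u s t 0 = u.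
Proof. unfold scons; now rewrite ty_dec_refl. Qed.

Lemma scons_shift (t : ty) (u : tm t) (s : sub) : scomp (scons u s) (shift t) = s.
Proof.
  extensionality r; extensionality n; unfold scomp, shift, scons.
  destruct (ty_dec t r) as [e|e] eqn:E; simpl; now rewrite E.
Qed.

(** The variable 0 of type [t] and the range of the shift together exhaust all variables. This
    principle spares the identities on [up] a case distinction on types. *)
Lemma sub_eq_shift (t : ty) (s s' : sub) :
  s t 0 = s' t 0 -> scomp s (shift t) = scomp s' (shift t) -> s = s'.
Proof.
  intros H0 H; extensionality r; extensionality n.
  assert (Hn := f_equal (fun f : sub => f r) H).
  unfold scomp, shift in Hn; simpl in Hn.
  destruct (ty_dec t r) as [e|e].
  - subst r; destruct n as [|n]; [exact H0|].
    exact (f_equal (fun f => f n) Hn).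
  - exact (f_equal (fun f => f n) Hn).
Qed.

Lemma up_comp (t : ty) (s s' : sub) : scomp (up t s) (up t s') = up t (scomp s s').
Proof.
  apply (sub_eq_shift t).
  - unfold scomp at 1, up; rewrite !scons0; simpl; now rewrite scons0.
  - rewrite <- scompA; unfold up at 2 3; rewrite !scons_shift.
    change (fun r n => tsub (shift t) (s' r n)) with (scomp (shift t) s').
    rewrite scompA; unfold up; rewrite scons_shift.
    change (fun r n => tsub (shift t) (scomp s s' r n)) with (scomp (shift t) (scomp s s')).
    now rewrite scompA.
Qed.

Lemma up_Var (t : ty) : up t Var = Var.
Proof.
  apply (sub_eq_shift t); [apply scons0|].
  unfold up at 1; rewrite scons_shift.
  extensionality r; extensionality n; symmetry; apply tsub_Var.
Qed.

Lemma fsub_fsub (A : fm) : forall s s', fsub s (fsub s' A) = fsub (scomp s s') A.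
Proof.
  induction A; intros s s'; simpl;
    rewrite ?tsub_tsub, ?IHA1, ?IHA2; try reflexivity.
  now rewrite IHA, up_comp.
Qed.

Lemma fsub_Var (A : fm) : fsub Var A = A.
Proof.
  induction A; simpl; rewrite ?tsub_Var, ?up_Var, ?IHA, ?IHA1, ?IHA2; reflexivity.
Qed.

Lemma scomp_Var (s : sub) : scomp s Var = s.
Proof. now extensionality r; extensionality n. Qed.

Lemma scomp_scons (t : ty) (s s' : sub) (u : tm t) :
  scomp s (scons u s') = scons (tsub s u) (scomp s s').
Proof.
  apply (sub_eq_shift t).
  - unfold scomp; now rewrite !scons0.
  - now rewrite <- scompA, !scons_shift.
Qed.

Lemma scons_up (t : ty) (s s' : sub) (u : tm t) :
  scomp (scons u s') (up t s) = scons u (scomp s' s).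
Proof.
  unfold up; rewrite scomp_scons; simpl; rewrite scons0.
  change (fun r n => tsub (shift t) (s r n)) with (scomp (shift t) s).
  now rewrite scompA, scons_shift.
Qed.

Lemma scomp_Var_l (s : sub) : scomp Var s = s.
Proof. extensionality r; extensionality n; apply tsub_Var. Qed.

(** * Weakening and change of axioms *)

Lemma prv_weak T G A : prv T G A -> forall G', incl G G' -> prv T G' A.
Proof.
  induction 1; intros G' HG.
  - now apply prv_ax.
  - apply prv_hyp; auto.
  - apply prv_imp_i, IHprv. intros C [<-|HC]; [now left|right; auto].
  - eapply prv_imp_e; eauto.
  - apply prv_all_i, IHprv, incl_map, HG.
  - apply prv_all_e; auto.
  - apply prv_dne; auto.
Qed.

Lemma prv_trans T T' G A :
  (forall B, T B -> prv T' nil B) -> prv T G A -> prv T' G A.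
Proof.
  intros HT; induction 1.
  - apply prv_weak with nil; [auto|easy].
  - now apply prv_hyp.
  - now apply prv_imp_i.
  - eapply prv_imp_e; eauto.
  - now apply prv_all_i.
  - now apply prv_all_e.
  - now apply prv_dne.
Qed.

(** * Completeness *)

Section Completeness.
Variable T : fm -> Prop.
Hypothesis T_closed : forall A, T A -> forall s, fsub s A = A.

(** Axioms are fixed by every substitution. Below a quantifier the induction hypothesis is used for
    [up t s], which commutes with the shift of the context. *)
Lemma prv_sub G A : prv T G A -> forall s, prv T (map (fsub s) G) (fsub s A).
Proof.
  induction 1; intros s; simpl.
  - rewrite T_closed by assumption; now apply prv_ax.
  - apply prv_hyp, in_map, H.
  - apply prv_imp_i, (IHprv s).
  - eapply prv_imp_e; [apply (IHprv1 s)|apply (IHprv2 s)].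
  - apply prv_all_i. specialize (IHprv (up t s)).
    rewrite map_map in *.
    erewrite map_ext; [exact IHprv|]. intros C; simpl.
    rewrite !fsub_fsub; f_equal. unfold up; now rewrite scons_shift.
  - rewrite fsub_fsub.
    replace (scomp s (scons u Var)) with (scomp (scons (tsub s u) Var) (up t s)).
    + rewrite <- fsub_fsub; apply prv_all_e, (IHprv s).
    + now rewrite scons_up, scomp_scons, scomp_Var, scomp_Var_l.
  - apply prv_dne, (IHprv s).
Qed.

(* All free variables of [A] have indices below [N]. *)
Definition vars_below (N : nat) (A : fm) : Prop :=
  forall s s' : sub, (forall r n, n < N -> s r n = s' r n) -> fsub s A = fsub s' A.

Lemma tm_vars_below (t : ty) (u : tm t) : exists N, forall s s' : sub,
  (forall r n, n < N -> s r n = s' r n) -> tsub s u = tsub s' u.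
Proof.
  induction u; try (exists 0; reflexivity).
  - exists (S n); intros s s' H; apply H; lia.
  - destruct IHu1 as [N1 H1], IHu2 as [N2 H2]; exists (N1 + N2); intros s' s'' H; simpl.
    rewrite (H1 s' s''), (H2 s' s''); [easy| |]; intros; apply H; lia.
Qed.

Lemma vars_below_le N N' A : N <= N' -> vars_below N A -> vars_below N' A.
Proof. intros HN H s s' Hs; apply H; intros; apply Hs; lia. Qed.

Lemma fm_vars_below A : exists N, vars_below N A.
Proof.
  induction A as [|a b|a b|A [n IHA] B [m IHB]|t A [n IHA]].
  - now exists 0.
  - destruct (tm_vars_below _ a) as [n Ha], (tm_vars_below _ b) as [m Hb].
    exists (n + m); intros s s' H; simpl.
    rewrite (Ha s s'), (Hb s s'); [easy| |]; intros; apply H; lia.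
  - destruct (tm_vars_below _ a) as [n Ha], (tm_vars_below _ b) as [m Hb].
    exists (n + m); intros s s' H; simpl.
    rewrite (Ha s s'), (Hb s s'); [easy| |]; intros; apply H; lia.
  - exists (n + m); intros s s' H; simpl.
    rewrite (IHA s s'), (IHB s s'); [easy| |]; intros; apply H; lia.
  - exists n; intros s s' H; simpl; f_equal; apply IHA; intros r k Hk.
    unfold up, scons; destruct (ty_dec t r) as [e|e].
    + destruct k; [easy|]. rewrite H; [easy|lia].
    + now rewrite H.
Qed.

Lemma list_vars_below G : exists N, Forall (vars_below N) G.
Proof.
  induction G as [|A G [n IH]]; [now exists 0|].
  destruct (fm_vars_below A) as [m HA]; exists (n + m); constructor.
  - eapply vars_below_le; [|exact HA]; lia.
  - eapply Forall_impl; [|exact IH]. intros B; apply vars_below_le; lia.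
Qed.

(** The variable [N] of type [t] occurs neither in [G] nor in [A], so it serves as an eigenvariable;
    this replaces the new constants of the usual Henkin construction. *)
Lemma prv_generalize N G t A :
  Forall (vars_below N) G -> vars_below N A ->
  prv T G (fsub (scons (Var t N) Var) A) -> prv T G (All t A).
Proof.
  intros HG HA H; apply prv_all_i.
  (* This renaming sends the eigenvariable to index 0 and raises the other variables of type [t]: it
     acts as the shift on [G] and turns the instance back into [A]. *)
  pose (rho := (fun r n => if ty_dec t r then
    if Nat.eq_dec n N then Var r 0 else Var r (S n) else Var r n) : sub).
  apply (fun H => prv_sub _ _ H rho) in H.
  rewrite fsub_fsub in H.
  replace (fsub (scomp rho (scons (Var t N) Var)) A) with A in H.
  - erewrite map_ext_in; [exact H|]. intros C HC; simpl.
    rewrite Forall_forall in HG; apply (HG C HC); intros r n Hn.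
    unfold rho, shift; destruct (ty_dec t r); [|easy].
    destruct (Nat.eq_dec n N); [lia|easy].
  - rewrite <- (fsub_Var A) at 1; apply HA; intros r n Hn.
    unfold scomp, scons, rho; destruct (ty_dec t r) as [<-|e] eqn:E.
    + destruct n as [|n]; simpl; rewrite E.
      * now destruct (Nat.eq_dec N N).
      * destruct (Nat.eq_dec n N); [lia|easy].
    + simpl; now rewrite E.
Qed.

Definition cons_ctx (G : list fm) : Prop := ~ prv T G Bot.

Lemma prv_contra G A : ~ prv T G A -> cons_ctx (Neg A :: G).
Proof. intros H H'; apply H, prv_dne, prv_imp_i, H'. Qed.

(* Surjections from the natural numbers onto types, terms and formulas; [k] is fuel. *)
Fixpoint dty (k n : nat) : ty :=
  match k with
  | O => N0
  | S k => let (a, b) := of_nat n in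
           let (c, d) := of_nat b in
           match a with O => N0 | S _ => Arr (dty k c) (dty k d) end
  end.

(** A code that decodes to a constant of the wrong type yields a variable, which keeps the
    enumeration total. *)
Definition cast {r : ty} (t : ty) (u : tm r) : tm t :=
  match ty_dec r t with
  | left e => eq_rect r tm u t e
  | right _ => Var t 0
  end.

Lemma cast_refl (t : ty) (u : tm t) : cast t u = u.
Proof. unfold cast; now rewrite ty_dec_refl. Qed.

Definition ety (n : nat) : ty := let (k, m) := of_nat n in dty k m.

Fixpoint dtm (k n : nat) (t : ty) : tm t :=
  match k with
  | O => Var t 0
  | S k =>
    let (a, b) := of_nat n in
    let (c, d) := of_nat b in
    let (d1, d2) := of_nat d in
    match a with
    | 0 => Var t b
    | 1 => cast t Zero
    | 2 => cast t One
    | 3 => cast t Plus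
    | 4 => cast t Times
    | 5 => cast t (Pi (ety c) (ety d))
    | 6 => cast t (Sigma (ety c) (ety d1) (ety d2))
    | 7 => cast t Rec
    | _ => App (dtm k d1 (Arr (ety c) t)) (dtm k d2 (ety c))
    end
  end.

Fixpoint dfm (k n : nat) : fm :=
  match k with
  | O => Bot
  | S k =>
    let (a, b) := of_nat n in
    let (c, d) := of_nat b in
    match a with
    | 0 => Bot
    | 1 => Eq0 (dtm k c N0) (dtm k d N0)
    | 2 => Lt0 (dtm k c N0) (dtm k d N0)
    | 3 => Imp (dfm k c) (dfm k d)
    | _ => All (ety c) (dfm k d)
    end
  end.

Definition efm (n : nat) : fm := let (k, m) := of_nat n in dfm k m.

(** Correctness for all large fuel, rather than for some, is what the induction needs: both
    components are decoded with the same fuel. *)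
Lemma dty_surj t : exists n k0, forall k, k0 <= k -> dty k n = t.
Proof.
  induction t as [|s [n [k1 IH1]] t [m [k2 IH2]]].
  - exists (to_nat (0, 0)), 0; intros [|k] _; [easy|]; cbn [dty].
    rewrite cancel_of_to. now destruct (of_nat 0).
  - exists (to_nat (1, to_nat (n, m))), (S (k1 + k2)); intros [|k] Hk; [lia|].
    cbn [dty]; repeat (rewrite cancel_of_to; cbv beta iota); rewrite IH1, IH2 by lia; easy.
Qed.

Lemma ety_surj t : exists n, ety n = t.
Proof.
  destruct (dty_surj t) as [n [k H]]; exists (to_nat (k, n)).
  unfold ety; rewrite cancel_of_to; now apply H.
Qed.

Lemma dtm_surj t (u : tm t) : exists n k0, forall k, k0 <= k -> dtm k n t = u.
Proof.
  induction u as [t n| | | | |s t|r s t| |s t f [n [k1 IH1]] x [m [k2 IH2]]].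
  1: exists (to_nat (0, n)), 1.
  2: exists (to_nat (1, 0)), 1.
  3: exists (to_nat (2, 0)), 1.
  4: exists (to_nat (3, 0)), 1.
  5: exists (to_nat (4, 0)), 1.
  6: destruct (ety_surj s) as [c <-], (ety_surj t) as [d <-];
     exists (to_nat (5, to_nat (c, d))), 1.
  7: destruct (ety_surj r) as [c <-], (ety_surj s) as [d1 <-], (ety_surj t) as [d2 <-];
     exists (to_nat (6, to_nat (c, to_nat (d1, d2)))), 1.
  8: exists (to_nat (7, 0)), 1.
  9: destruct (ety_surj s) as [c <-];
     exists (to_nat (8, to_nat (c, to_nat (n, m)))), (S (k1 + k2)).
  all: intros [|k] Hk; [lia|]; cbn [dtm]; repeat (rewrite cancel_of_to; cbv beta iota);
    rewrite ?IH1, ?IH2 by lia;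
    repeat match goal with |- context [of_nat ?x] => destruct (of_nat x) end;
    now rewrite ?cast_refl.
Qed.

Lemma dfm_surj A : exists n k0, forall k, k0 <= k -> dfm k n = A.
Proof.
  induction A as [|a b|a b|A [n [k1 IH1]] B [m [k2 IH2]]|t A [m [k2 IH2]]].
  - exists (to_nat (0, 0)), 1.
    intros [|k] Hk; [lia|]; cbn [dfm]; rewrite cancel_of_to; now destruct (of_nat 0).
  - destruct (dtm_surj _ a) as [n [k1 H1]], (dtm_surj _ b) as [m [k2 H2]].
    exists (to_nat (1, to_nat (n, m))), (S (k1 + k2)).
    intros [|k] Hk; [lia|]; cbn [dfm]; repeat (rewrite cancel_of_to; cbv beta iota); rewrite H1, H2 by lia; easy.
  - destruct (dtm_surj _ a) as [n [k1 H1]], (dtm_surj _ b) as [m [k2 H2]].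
    exists (to_nat (2, to_nat (n, m))), (S (k1 + k2)).
    intros [|k] Hk; [lia|]; cbn [dfm]; repeat (rewrite cancel_of_to; cbv beta iota); rewrite H1, H2 by lia; easy.
  - exists (to_nat (3, to_nat (n, m))), (S (k1 + k2)).
    intros [|k] Hk; [lia|]; cbn [dfm]; repeat (rewrite cancel_of_to; cbv beta iota); rewrite IH1, IH2 by lia; easy.
  - destruct (ety_surj t) as [n <-].
    exists (to_nat (4, to_nat (n, m))), (S k2).
    intros [|k] Hk; [lia|]; cbn [dfm]; repeat (rewrite cancel_of_to; cbv beta iota); rewrite IH2 by lia; easy.
Qed.

Lemma efm_surj A : exists n, efm n = A.
Proof.
  destruct (dfm_surj A) as [n [k H]]; exists (to_nat (k, n)).
  unfold efm; rewrite cancel_of_to; now apply H.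
Qed.

Variable phi : fm.
Hypothesis phi_unprovable : ~ prv T nil phi.

(** If [A] cannot be added consistently, [G] does not prove it, and its negation can be added. A
    rejected universal formula receives a counterexample at once: since [G] is a finite list, some
    variable is fresh, and refuting its instance stays consistent by [prv_generalize]. *)
Lemma henkin_step (G : list fm) (A : fm) : cons_ctx G -> exists G',
  cons_ctx G' /\ incl G G' /\
  (In A G' \/
   (In (Neg A) G' /\ forall t B, A = All t B -> exists u : tm t, In (Neg (fsub (scons u Var) B)) G')).
Proof.
  intros HG. destruct (classic (cons_ctx (A :: G))) as [HA|HA].
  { exists (A :: G); repeat split; [easy|now apply incl_tl|left; now left]. }
  assert (H : ~ prv T G A).
  { intros H; apply HA; intros H'; apply HG.
    eapply prv_imp_e; [apply prv_imp_i, H'|exact H]. }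
  destruct (classic (exists t B, A = All t B)) as [[t [B ->]]|HN].
  - destruct (list_vars_below (B :: G)) as [N HN]; inversion_clear HN.
    exists (Neg (fsub (scons (Var t N) Var) B) :: Neg (All t B) :: G); repeat split.
    + apply prv_contra. intros HB. apply (prv_contra _ _ H).
      eapply prv_imp_e; [apply prv_hyp; left; reflexivity|].
      apply prv_generalize with N; [|easy|easy].
      constructor; [|easy].
      intros s s' Hs; unfold Neg; cbn [fsub]; f_equal; f_equal.
      apply H0. intros r n Hn. unfold up, scons.
      destruct (ty_dec t r); [|now rewrite Hs].
      destruct n; [easy|]. rewrite Hs; [easy|lia].
    + intros C HC; right; now right.
    + right; split; [right; now left|]. intros t' B' E; injection E as -> ->.
      exists (Var t' N); now left.
  - exists (Neg A :: G); repeat split; [now apply prv_contra|now apply incl_tl|].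
    right; split; [now left|]. intros t B ->; exfalso; eauto.
Qed.

Fixpoint henkin (k : nat) : {G : list fm | cons_ctx G} :=
  match k with
  | O => exist _ (Neg phi :: nil) (prv_contra _ _ phi_unprovable)
  | S k =>
    let (G, HG) := henkin k in
    let (G', H) := constructive_indefinite_description _ (henkin_step G (efm k) HG) in
    exist _ G' (proj1 H)
  end.

Definition hctx (k : nat) : list fm := proj1_sig (henkin k).

Lemma hctx_S k : incl (hctx k) (hctx (S k)) /\ (In (efm k) (hctx (S k)) \/
   (In (Neg (efm k)) (hctx (S k)) /\ forall t B, efm k = All t B ->
      exists u : tm t, In (Neg (fsub (scons u Var) B)) (hctx (S k)))).
Proof.
  unfold hctx; simpl; destruct (henkin k) as [G HG]; simpl.
  destruct constructive_indefinite_description as [G' HG']; simpl; tauto.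
Qed.

Lemma hctx_mono k k' : k <= k' -> incl (hctx k) (hctx k').
Proof.
  induction 1; [apply incl_refl|]. eapply incl_tran; [exact IHle|apply hctx_S].
Qed.

Definition Th (A : fm) : Prop := exists k, prv T (hctx k) A.

Lemma Th_prv G A : (forall B, In B G -> Th B) -> prv T G A -> Th A.
Proof.
  revert A; induction G as [|B G IH]; intros A HG H.
  - exists 0; eapply prv_weak; [exact H|easy].
  - destruct (IH (Imp B A)) as [k1 H1]; [intros; apply HG; now right|now apply prv_imp_i|].
    destruct (HG B) as [k2 H2]; [now left|].
    exists (k1 + k2); apply prv_imp_e with B.
    + eapply prv_weak; [exact H1|apply hctx_mono; lia].
    + eapply prv_weak; [exact H2|apply hctx_mono; lia].
Qed.

Lemma Th_in k A : In A (hctx k) -> Th A.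
Proof. exists k; now apply prv_hyp. Qed.

Lemma Th_T A : T A -> Th A.
Proof. exists 0; now apply prv_ax. Qed.

Lemma Th_Bot : ~ Th Bot.
Proof. intros [k H]; exact (proj2_sig (henkin k) H). Qed.

Lemma Th_mp A B : Th (Imp A B) -> Th A -> Th B.
Proof.
  intros H1 H2; apply (Th_prv (Imp A B :: A :: nil)).
  - intros C [<-|[<-|[]]]; easy.
  - eapply prv_imp_e; apply prv_hyp; [now left|right; now left].
Qed.

Lemma Th_phi : ~ Th phi.
Proof.
  intros H; apply Th_Bot, (Th_mp phi Bot); [|exact H].
  apply (Th_in 0); now left.
Qed.

Lemma Th_dec A : Th A \/ Th (Neg A).
Proof.
  destruct (efm_surj A) as [k <-]; destruct (hctx_S k) as [_ [H|[H _]]].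
  - left; eapply Th_in, H.
  - right; eapply Th_in, H.
Qed.

Lemma Th_Imp A B : Th (Imp A B) <-> (Th A -> Th B).
Proof.
  split; [apply Th_mp|]. intros H.
  destruct (Th_dec A) as [HA|HA].
  - apply (Th_prv (B :: nil)); [intros C [<-|[]]; auto|].
    apply prv_imp_i, prv_hyp; right; now left.
  - apply (Th_prv (Neg A :: nil)); [intros C [<-|[]]; auto|].
    apply prv_imp_i, prv_dne, prv_imp_i, prv_imp_e with A; apply prv_hyp; simpl; auto.
Qed.

(** From right to left: the stage that decides the universal formula either contains it or contains
    a refuted instance, and all instances are in the theory. *)
Lemma Th_All t A : Th (All t A) <-> forall u : tm t, Th (fsub (scons u Var) A).
Proof.
  split.
  - intros [k H] u; exists k; now apply prv_all_e.
  - intros H; destruct (efm_surj (All t A)) as [k E].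
    destruct (hctx_S k) as [_ [Hk|[_ Hk]]].
    + rewrite E in Hk; eapply Th_in, Hk.
    + destruct (Hk t A E) as [u Hu]; exfalso; apply Th_Bot.
      eapply Th_mp; [eapply Th_in, Hu|apply H].
Qed.

End Completeness.

(** * Structures *)

(** Equality at type 0 is a relation of its own, because distinct terms of the term model can be
    provably equal. *)
Record structure : Type := Structure {
  dom : ty -> Type;
  ap : forall {s t : ty}, dom (s ~> t)%ty -> dom s -> dom t;
  zero : dom N0;
  one : dom N0;
  plus : dom (N0 ~> N0 ~> N0)%ty;
  times : dom (N0 ~> N0 ~> N0)%ty;
  pi : forall s t, dom (s ~> t ~> s)%ty;
  sigma : forall r s t, dom ((r ~> s ~> t) ~> (r ~> s) ~> r ~> t)%ty;
  rec : dom ((N0 ~> N0 ~> N0) ~> N0 ~> N0 ~> N0)%ty;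
  eq0 : dom N0 -> dom N0 -> Prop;
  lt0 : dom N0 -> dom N0 -> Prop
}.
Arguments ap {_ s t} _ _.
Arguments zero {_}.
Arguments one {_}.
Arguments plus {_}.
Arguments times {_}.
Arguments pi {_} s t.
Arguments sigma {_} r s t.
Arguments rec {_}.
Arguments eq0 {_} _ _.
Arguments lt0 {_} _ _.

Definition env (M : structure) : Type := forall t : ty, nat -> dom M t.

Definition econs {M : structure} {t : ty} (x : dom M t) (e : env M) : env M :=
  fun r =>
    match ty_dec t r with
    | left E => fun n => match n with
                         | O => eq_rect t (dom M) x r E
                         | S m => e r m
                         end
    | right _ => e r
    end.

Fixpoint eval {M : structure} (e : env M) {t : ty} (u : tm t) : dom M t :=
  match u in tm t return dom M t with
  | Var t n => e t n
  | Zero => zero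
  | One => one
  | Plus => plus
  | Times => times
  | Pi a b => pi a b
  | Sigma a b c => sigma a b c
  | Rec => rec
  | App f x => ap (eval e f) (eval e x)
  end.

Fixpoint sat {M : structure} (e : env M) (A : fm) : Prop :=
  match A with
  | Bot => False
  | Eq0 a b => eq0 (eval e a) (eval e b)
  | Lt0 a b => lt0 (eval e a) (eval e b)
  | Imp A B => sat e A -> sat e B
  | All t A => forall x : dom M t, sat (econs x e) A
  end.

Fixpoint eqm {M : structure} (t : ty) : dom M t -> dom M t -> Prop :=
  match t with
  | N0 => eq0
  | Arr r s => fun x y => forall z : dom M r, eqm s (ap x z) (ap y z)
  end.

(** * Semantics of formulas with named bound variables *)

Section Worlds.
Context {M : structure}.

Lemma econs0 t (x : dom M t) e : econs x e t 0 = x.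
Proof. unfold econs; now rewrite ty_dec_refl. Qed.

(* An environment together with the binding depth at which it is used. *)
Definition world : Type := env M * depth.

Definition push {t : ty} (x : dom M t) (w : world) : world :=
  (econs x (fst w), deeper t (snd w)).

Inductive extends (w : world) : world -> Prop :=
| extends_refl : extends w w
| extends_push w' t (x : dom M t) : extends w w' -> extends w (push x w').

(** The value is prescribed in all extensions of the world, since a named variable computes its
    index from the depth at which it is finally used. *)
Definition denotes (w : world) {t : ty} (u : Tm t) (x : dom M t) : Prop :=
  forall w', extends w w' -> eval (fst w') (u (snd w')) = x.

Definition means (w : world) (A : Fm) (P : Prop) : Prop :=
  forall w', extends w w' -> (sat (fst w') (A (snd w')) <-> P).

Lemma extends_trans w w' w'' : extends w w' -> extends w' w'' -> extends w w''.
Proof. intros H; induction 1; [easy|now constructor]. Qed.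

Lemma denotes_extends w w' t (u : Tm t) x : extends w w' -> denotes w u x -> denotes w' u x.
Proof. intros H Hu w'' Hw; apply Hu; eapply extends_trans; eauto. Qed.

(** Pushing a value raises the depth and the index of every older variable of that type by one, so
    their difference keeps pointing to the same value. *)
Lemma extends_lookup w w' : extends w w' -> forall r, snd w r <= snd w' r /\
  forall k, fst w' r (snd w' r - snd w r + k) = fst w r k.
Proof.
  induction 1 as [|[e d] t x H IH]; intros r.
  - split; [lia|]. intros k; now replace (snd w r - snd w r + k) with k by lia.
  - destruct (IH r) as [IH1 IH2]; simpl in *; unfold deeper, econs.
    destruct (ty_dec t r) as [<-|n]; [|now split].
    split; [lia|]. intros k.
    now replace (S (d t) - snd w t + k) with (S (d t - snd w t + k)) by lia.
Qed.

Lemma denotes_var w t (x : dom M t) :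
  denotes (push x w) (fun d => Var t (d t - S (snd w t))) x.
Proof.
  intros w' H; destruct (extends_lookup _ _ H t) as [H1 H2]; simpl in *.
  specialize (H2 0); rewrite econs0 in H2; unfold deeper in H2; rewrite ty_dec_refl in H2.
  now rewrite Nat.add_0_r in H2.
Qed.

Lemma denotes_cst w t (c : tm t) x :
  (forall e, eval e c = x) -> denotes w (cst c) x.
Proof. intros H w' _; apply H. Qed.

Lemma denotes_app w s t (f : Tm (s ~> t)) (u : Tm s) g x :
  denotes w f g -> denotes w u x -> denotes w (bapp f u) (ap g x).
Proof. intros Hf Hu w' H; unfold bapp; simpl; now rewrite (Hf w'), (Hu w'). Qed.

Lemma means_eq0 w a b x y : denotes w a x -> denotes w b y -> means w (beq0 a b) (eq0 x y).
Proof. intros Ha Hb w' H; unfold beq0; simpl; now rewrite (Ha w'), (Hb w'). Qed.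

Lemma means_lt0 w a b x y : denotes w a x -> denotes w b y -> means w (blt0 a b) (lt0 x y).
Proof. intros Ha Hb w' H; unfold blt0; simpl; now rewrite (Ha w'), (Hb w'). Qed.

Lemma means_imp w A B P Q : means w A P -> means w B Q -> means w (bimp A B) (P -> Q).
Proof.
  intros HA HB w' H; unfold bimp; simpl; now rewrite (HA w' H), (HB w' H).
Qed.

Lemma means_neg w A P : means w A P -> means w (bneg A) (~ P).
Proof. intros HA w' H; unfold bneg; simpl; now rewrite (HA w' H). Qed.

Lemma means_and w A B P Q : means w A P -> means w B Q -> means w (band A B) (P /\ Q).
Proof.
  intros HA HB w' H; unfold band; simpl; rewrite (HA w' H), (HB w' H).
  split; [|tauto]. intros HPQ; apply NNPP; tauto.
Qed.

Lemma means_or w A B P Q : means w A P -> means w B Q -> means w (bor A B) (P \/ Q).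
Proof.
  intros HA HB w' H; unfold bor; simpl; rewrite (HA w' H), (HB w' H).
  split; [|tauto]. intros HPQ; destruct (classic P); tauto.
Qed.

Lemma means_iff w A B P Q : means w A P -> means w B Q -> means w (biff A B) (P <-> Q).
Proof. intros HA HB; apply means_and; now apply means_imp. Qed.

(** The hypothesis speaks of any term denoting [x] in any later world; the variable introduced by
    the quantifier is one of these. *)
Lemma means_all w t (F : Tm t -> Fm) (P : dom M t -> Prop) :
  (forall w' x u, extends w w' -> denotes w' u x -> means w' (F u) (P x)) ->
  means w (ball t F) (forall x, P x).
Proof.
  intros HF w' H; unfold ball; simpl.
  split; intros HP x; specialize (HP x).
  - exact (proj1 (HF (push x w') x _ (extends_trans _ _ _ H (extends_push _ _ t x (extends_refl _)))
      (denotes_var w' t x) (push x w') (extends_refl _)) HP).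
  - exact (proj2 (HF (push x w') x _ (extends_trans _ _ _ H (extends_push _ _ t x (extends_refl _)))
      (denotes_var w' t x) (push x w') (extends_refl _)) HP).
Qed.

Lemma means_ex w t (F : Tm t -> Fm) (P : dom M t -> Prop) :
  (forall w' x u, extends w w' -> denotes w' u x -> means w' (F u) (P x)) ->
  means w (bex t F) (exists x, P x).
Proof.
  intros HF.
  assert (E : means w (bneg (ball t (fun u => bneg (F u)))) (~ forall x, ~ P x)).
  { apply means_neg, (means_all w t _ (fun x => ~ P x)); intros; now apply means_neg, HF. }
  intros w' H; refine (iff_trans (E w' H) _).
  split; [apply not_all_not_ex|firstorder].
Qed.

Lemma means_beq w t : forall a b x y,
  denotes w a x -> denotes w b y -> means w (beq t a b) (eqm t x y).
Proof.
  revert w; induction t as [|r _ s IH]; intros w a b x y Ha Hb; [now apply means_eq0|].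
  apply (means_all w r (fun z => beq s (bapp a z) (bapp b z))).
  intros w' z u H Hu; apply IH; apply denotes_app; eauto using denotes_extends.
Qed.

Lemma means_iff_prop w A P Q : (P <-> Q) -> means w A P -> means w A Q.
Proof. intros E HA w' H; now rewrite <- E, (HA w' H). Qed.

Lemma sat_sentence e A P : means (e, fun _ => 0) A P -> sat e (sentence A) <-> P.
Proof. intros H; apply (H (e, fun _ => 0)); constructor. Qed.

End Worlds.

Definition normal (M : structure) : Prop :=
  (forall x y : dom M N0, eq0 x y <-> x = y) /\
  (forall s t (f g : dom M (s ~> t)%ty), (forall x, ap f x = ap g x) -> f = g).

Lemma means_eq M w a b (x y : dom M N0) :
  normal M -> denotes w a x -> denotes w b y -> means w (beq0 a b) (x = y).
Proof. intros H Ha Hb; eapply means_iff_prop; [apply H|now apply means_eq0]. Qed.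

Ltac denote :=
  match goal with
  | H : denotes ?w ?u _ |- denotes ?w ?u _ => exact H
  | E : extends ?w ?w', H : denotes ?w ?u _ |- denotes ?w' ?u _ =>
      exact (denotes_extends _ _ _ _ _ E H)
  | |- denotes _ (bapp _ _) _ => apply denotes_app; denote
  | |- denotes _ (cst _) _ => apply denotes_cst; intros; reflexivity
  end.

Ltac mean :=
  cbv beta;
  lazymatch goal with
  | |- means _ (ball _ _) _ =>
      refine (means_all _ _ _ _ _); intros ? ? ? ? ?; persist; mean
  | |- means _ (bex _ _) _ =>
      refine (means_ex _ _ _ _ _); intros ? ? ? ? ?; persist; mean
  | |- means _ (bimp _ _) _ => apply means_imp; mean
  | |- means _ (band _ _) _ => apply means_and; mean
  | |- means _ (bor _ _) _ => apply means_or; mean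
  | |- means _ (biff _ _) _ => apply means_iff; mean
  | |- means _ (bneg _) _ => apply means_neg; mean
  | |- means _ (all_in _ _) _ => unfold all_in, mem; mean
  | |- means _ (ex_in _ _) _ => unfold ex_in, mem; mean
  | |- means _ (mem _ _) _ => unfold mem; mean
  | |- means _ (beq0 _ _) (_ = _) => apply means_eq; [assumption|denote|denote]
  | |- means _ (beq0 _ _) _ => apply means_eq0; denote
  | |- means _ (blt0 _ _) _ => apply means_lt0; denote
  | |- means _ (beq _ _ _) _ => apply means_beq; denote
  | |- _ => idtac
  end
with persist :=
  match goal with
  | E : extends ?w ?w' |- _ =>
      repeat match goal with
      | H : denotes w _ _ |- _ => apply (denotes_extends _ _ _ _ _ E) in H
      end; clear E
  end.

(** * Closed sentences *)

Section Closed.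

Definition closed_below (d : depth) (s : sub) : Prop :=
  forall r n, n < d r -> s r n = Var r n.

(** A substitution that fixes the indices below the depth does not affect the term. At depth 0 every
    substitution is of this kind, which makes sentences closed. *)
Definition tm_below (d : depth) {t : ty} (u : Tm t) : Prop :=
  forall d', (forall r, d r <= d' r) -> forall s, closed_below d' s -> tsub s (u d') = u d'.

Definition fm_below (d : depth) (A : Fm) : Prop :=
  forall d', (forall r, d r <= d' r) -> forall s, closed_below d' s -> fsub s (A d') = A d'.

Lemma tm_below_le d d' t (u : Tm t) : (forall r, d r <= d' r) -> tm_below d u -> tm_below d' u.
Proof. intros H Hu d'' H'; apply Hu; intros r; specialize (H r); specialize (H' r); lia. Qed.

Lemma below_app d s t (f : Tm (s ~> t)) u :
  tm_below d f -> tm_below d u -> tm_below d (bapp f u).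
Proof. intros Hf Hu d' H q Hq; unfold bapp; simpl; now rewrite Hf, Hu. Qed.

Lemma below_cst d t (c : tm t) : (forall s, tsub s c = c) -> tm_below d (cst c).
Proof. intros H d' _ s _; apply H. Qed.

Lemma below_eq0 d a b : tm_below d a -> tm_below d b -> fm_below d (beq0 a b).
Proof. intros Ha Hb d' H q Hq; unfold beq0; simpl; now rewrite Ha, Hb. Qed.

Lemma below_lt0 d a b : tm_below d a -> tm_below d b -> fm_below d (blt0 a b).
Proof. intros Ha Hb d' H q Hq; unfold blt0; simpl; now rewrite Ha, Hb. Qed.

Lemma below_imp d A B : fm_below d A -> fm_below d B -> fm_below d (bimp A B).
Proof. intros Ha Hb d' H q Hq; unfold bimp; simpl; now rewrite Ha, Hb. Qed.

Lemma below_neg d A : fm_below d A -> fm_below d (bneg A).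
Proof. intros Ha d' H q Hq; unfold bneg; simpl; now rewrite Ha. Qed.

Lemma below_and d A B : fm_below d A -> fm_below d B -> fm_below d (band A B).
Proof. intros Ha Hb d' H q Hq; unfold band; simpl; now rewrite Ha, Hb. Qed.

Lemma below_or d A B : fm_below d A -> fm_below d B -> fm_below d (bor A B).
Proof. intros Ha Hb d' H q Hq; unfold bor; simpl; now rewrite Ha, Hb. Qed.

Lemma below_iff d A B : fm_below d A -> fm_below d B -> fm_below d (biff A B).
Proof. intros HA HB; apply below_and; now apply below_imp. Qed.

Lemma below_all d t (F : Tm t -> Fm) :
  (forall d' u, (forall r, d r <= d' r) -> tm_below d' u -> fm_below d' (F u)) ->
  fm_below d (ball t F).
Proof.
  intros HF d' H s Hs; unfold ball; simpl; f_equal.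
  apply (HF (deeper t d')).
  - intros r; unfold deeper; specialize (H r); destruct (ty_dec t r); lia.
  - intros d'' H' s' Hs'; simpl; apply Hs'.
    specialize (H' t); unfold deeper in H'; rewrite ty_dec_refl in H'; lia.
  - easy.
  - intros r n Hn; unfold up, scons, deeper in *.
    destruct (ty_dec t r) as [<-|n'] eqn:E.
    + destruct n as [|n]; [easy|]. rewrite Hs by lia; simpl; unfold shift; now rewrite E.
    + rewrite Hs by lia; simpl; unfold shift; now rewrite E.
Qed.

Lemma below_ex d t (F : Tm t -> Fm) :
  (forall d' u, (forall r, d r <= d' r) -> tm_below d' u -> fm_below d' (F u)) ->
  fm_below d (bex t F).
Proof.
  intros HF; change (fm_below d (bneg (ball t (fun u => bneg (F u))))).
  apply below_neg, below_all; intros; now apply below_neg, HF.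
Qed.

Lemma below_beq d t : forall a b, tm_below d a -> tm_below d b -> fm_below d (beq t a b).
Proof.
  revert d; induction t as [|r _ s IH]; intros d a b Ha Hb; [now apply below_eq0|].
  apply (below_all d r (fun z => beq s (bapp a z) (bapp b z))).
  intros d' u H Hu; apply IH; apply below_app; eauto using tm_below_le.
Qed.

Lemma sentence_closed A : fm_below (fun _ => 0) A -> forall s, fsub s (sentence A) = sentence A.
Proof. intros H s; apply H; [easy|]. intros r n Hn; lia. Qed.

End Closed.

Ltac keep :=
  let d := fresh "d" in let u := fresh "u" in let E := fresh "E" in let Hu := fresh "Hu" in
  intros d u E Hu;
  repeat match goal with
  | H : tm_below _ _ |- _ => apply (tm_below_le _ _ _ _ E) in H
  end;
  clear E.

Ltac below :=
  cbv beta;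
  lazymatch goal with
  | |- fm_below _ (ball _ _) => apply below_all; keep; below
  | |- fm_below _ (bex _ _) => apply below_ex; keep; below
  | |- fm_below _ (bimp _ _) => apply below_imp; below
  | |- fm_below _ (band _ _) => apply below_and; below
  | |- fm_below _ (bor _ _) => apply below_or; below
  | |- fm_below _ (biff _ _) => apply below_iff; below
  | |- fm_below _ (bneg _) => apply below_neg; below
  | |- fm_below _ (beq0 _ _) => apply below_eq0; below
  | |- fm_below _ (blt0 _ _) => apply below_lt0; below
  | |- fm_below _ (beq _ _ _) => apply below_beq; below
  | |- tm_below _ (bapp _ _) => apply below_app; below
  | |- tm_below _ (cst _) => apply below_cst; reflexivity
  | |- tm_below _ _ => assumption
  end.

(** * Extensional models *)

Section Quotient.
Variable M : structure.
Hypothesis eq0_refl : forall x : dom M N0, eq0 x x.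
Hypothesis eq0_sym : forall x y : dom M N0, eq0 x y -> eq0 y x.
Hypothesis eq0_trans : forall x y z : dom M N0, eq0 x y -> eq0 y z -> eq0 x z.
Hypothesis lt0_eq0 : forall x y u v : dom M N0, eq0 x y -> eq0 u v -> lt0 x u -> lt0 y v.
Hypothesis ap_eqm : forall r t (x y : dom M r) (f : dom M (r ~> t)%ty),
  eqm r x y -> eqm t (ap f x) (ap f y).

Lemma eqm_refl t (x : dom M t) : eqm t x x.
Proof. induction t; simpl; auto. Qed.

Lemma eqm_sym t (x y : dom M t) : eqm t x y -> eqm t y x.
Proof. induction t; simpl; auto. Qed.

Lemma eqm_trans t (x y z : dom M t) : eqm t x y -> eqm t y z -> eqm t x z.
Proof. induction t; simpl; eauto. Qed.

(** The choice depends on the equivalence class only, as a predicate. Equivalent elements thus have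
    the same representative, and the quotient is a subset of the original domain. *)
Definition rep {t : ty} (x : dom M t) : dom M t := epsilon (inhabits x) (eqm t x).

Lemma rep_eqm t (x : dom M t) : eqm t x (rep x).
Proof. apply (epsilon_spec (inhabits x) (eqm t x)); exists x; apply eqm_refl. Qed.

Lemma rep_eq t (x y : dom M t) : eqm t x y <-> rep x = rep y.
Proof.
  split.
  - intros H; unfold rep.
    replace (eqm t y) with (eqm t x); [f_equal; apply proof_irrelevance|].
    extensionality z; apply propositional_extensionality.
    split; eauto using eqm_trans, eqm_sym.
  - intros H; apply eqm_trans with (rep x); [apply rep_eqm|].
    rewrite H; apply eqm_sym, rep_eqm.
Qed.

Definition qdom (t : ty) : Type := {x : dom M t | rep x = x}.

Definition cls {t : ty} (x : dom M t) : qdom t :=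
  exist _ (rep x) (proj1 (rep_eq t _ _) (eqm_sym _ _ _ (rep_eqm t x))).

Lemma cls_eq t (x y : dom M t) : cls x = cls y <-> eqm t x y.
Proof.
  rewrite rep_eq; split; intros H.
  - exact (f_equal (@proj1_sig _ _) H).
  - apply subset_eq_compat, H.
Qed.

Lemma cls_surj t (x : qdom t) : exists y, x = cls y.
Proof. destruct x as [x E]; exists x; apply subset_eq_compat; now rewrite E. Qed.

Definition quotient : structure := {|
  dom := qdom;
  ap s t f x := cls (ap (proj1_sig f) (proj1_sig x));
  zero := cls zero;
  one := cls one;
  plus := cls plus;
  times := cls times;
  pi s t := cls (pi s t);
  sigma r s t := cls (sigma r s t);
  rec := cls rec;
  eq0 := eq;
  lt0 x y := lt0 (proj1_sig x) (proj1_sig y) |}.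

Lemma ap_cls s t (f : dom M (s ~> t)%ty) (x : dom M s) :
  @ap quotient s t (cls f) (cls x) = cls (ap f x).
Proof.
  apply cls_eq; simpl. apply eqm_trans with (ap f (rep x)).
  - exact (eqm_sym _ _ _ (rep_eqm _ f (rep x))).
  - apply ap_eqm, eqm_sym, rep_eqm.
Qed.

Lemma quotient_normal : normal quotient.
Proof.
  split; [easy|]. intros s t f g H.
  destruct (cls_surj _ f) as [f' ->], (cls_surj _ g) as [g' ->].
  apply cls_eq; simpl; intros x; apply cls_eq; rewrite <- !ap_cls; apply H.
Qed.

Lemma eval_quotient (e : env M) t (u : tm t) :
  @eval quotient (fun r n => cls (e r n)) t u = cls (eval e u).
Proof. induction u; try reflexivity. simpl eval. rewrite IHu1, IHu2. apply ap_cls. Qed.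

Lemma sat_quotient A : forall e : env M, @sat quotient (fun r n => cls (e r n)) A <-> sat e A.
Proof.
  induction A as [|a b|a b|A IHA B IHB|t A IH]; intros e.
  - easy.
  - cbn [sat]; rewrite !eval_quotient. apply cls_eq.
  - cbn [sat]; rewrite !eval_quotient; simpl.
    assert (Ha := rep_eqm _ (eval e a)); assert (Hb := rep_eqm _ (eval e b)).
    simpl in *; split; apply lt0_eq0; auto.
  - simpl; now rewrite IHA, IHB.
  - assert (H : forall x : dom M t,
      @econs quotient t (cls x) (fun r n => cls (e r n)) = fun r n => cls (econs x e r n)).
    { intros x; extensionality r; extensionality n; unfold econs.
      destruct (ty_dec t r) as [<-|k]; [|easy]. now destruct n. }
    simpl; split; intros HA x.
    + apply IH; rewrite <- H; apply HA.
    + destruct (cls_surj _ x) as [y ->]; rewrite H; apply IH, HA.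
Qed.

End Quotient.

Definition models (M : structure) (T : fm -> Prop) : Prop :=
  forall A, T A -> forall e : env M, sat e A.

Local Open Scope hoa_scope.

Inductive equality_axioms : fm -> Prop :=
| eqax_refl : equality_axioms (sentence (all x : N0, x == x))
| eqax_sym : equality_axioms (sentence (all x : N0, all y : N0, x == y ==> y == x))
| eqax_trans : equality_axioms (sentence
    (all x : N0, all y : N0, all z : N0, x == y ==> y == z ==> x == z))
| eqax_lt : equality_axioms (sentence
    (all x : N0, all y : N0, all u : N0, all v : N0,
       x == y ==> u == v ==> x < u ==> y < v))
| eqax_ext (r t : ty) : equality_axioms (sentence
    (all x : r, all y : r, all phi : (r ~> t)%ty,
       beq r x y ==> beq t (phi @ x) (phi @ y))).

Local Close Scope hoa_scope.

Theorem completeness (T : fm -> Prop) (A : fm) :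
  (forall B, T B -> forall s, fsub s B = B) ->
  (forall B, equality_axioms B -> T B) ->
  (forall M, normal M -> models M T -> forall e : env M, sat e A) ->
  proves T A.
Proof.
  intros HT Heq H; apply NNPP; intros HA.
  pose (th := Th T HT A HA).
  (* The term model of the complete theory: its environments are substitutions, and evaluation is
     substitution. *)
  pose (M := {| dom := tm; ap := @App; zero := Zero; one := One; plus := Plus;
    times := Times; pi := Pi; sigma := Sigma; rec := Rec;
    eq0 a b := th (Eq0 a b); lt0 a b := th (Lt0 a b) |}).
  assert (Heval : forall (s : sub) t (u : tm t), @eval M s t u = tsub s u).
  { intros s t u; induction u; try reflexivity.
    simpl; now rewrite IHu1, IHu2. }
  assert (Hsat : forall B (s : sub), @sat M s B <-> th (fsub s B)).
  { induction B as [|a b|a b|B IHB C IHC|t B IH]; intros s; simpl.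
    - split; [easy|]; apply Th_Bot.
    - now rewrite !Heval.
    - now rewrite !Heval.
    - rewrite IHB, IHC; symmetry; now apply Th_Imp.
    - unfold th; rewrite Th_All.
      split; intros HB u; specialize (HB u).
      + rewrite fsub_fsub, scons_up, scomp_Var_l. now apply (IH (scons u s)).
      + rewrite fsub_fsub, scons_up, scomp_Var_l in HB. now apply (IH (scons u s)). }
  assert (HM : models M T).
  { intros B HB s; apply Hsat. rewrite HT by easy. now apply Th_T. }
  assert (E1 : forall x : dom M N0, eq0 x x).
  { refine (proj1 (sat_sentence (M := M) Var _ _ _) (HM _ (Heq _ eqax_refl) Var)). mean. }
  assert (E2 : forall x y : dom M N0, eq0 x y -> eq0 y x).
  { refine (proj1 (sat_sentence (M := M) Var _ _ _) (HM _ (Heq _ eqax_sym) Var)). mean. }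
  assert (E3 : forall x y z : dom M N0, eq0 x y -> eq0 y z -> eq0 x z).
  { refine (proj1 (sat_sentence (M := M) Var _ _ _) (HM _ (Heq _ eqax_trans) Var)). mean. }
  assert (E4 : forall x y u v : dom M N0, eq0 x y -> eq0 u v -> lt0 x u -> lt0 y v).
  { refine (proj1 (sat_sentence (M := M) Var _ _ _) (HM _ (Heq _ eqax_lt) Var)). mean. }
  assert (E5 : forall r t (x y : dom M r) (f : dom M (r ~> t)%ty),
     eqm r x y -> eqm t (ap f x) (ap f y)).
  { intros r t.
    refine (proj1 (sat_sentence (M := M) Var _ _ _) (HM _ (Heq _ (eqax_ext r t)) Var)). mean. }
  apply (Th_phi T HT A HA). fold th; rewrite <- (fsub_Var A); apply Hsat.
  apply (sat_quotient M E1 E2 E3 E4 E5). apply H.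
  - now apply quotient_normal.
  - intros B HB e.
    (* Each environment of the quotient lifts to one of the term model. *)
    pose (e' := (fun r n => proj1_sig (e r n)) : env M).
    replace e with ((fun r n => cls M E1 E2 E3 (e' r n)) : env (quotient M E1 E2 E3)).
    + apply (sat_quotient M E1 E2 E3 E4 E5), HM, HB.
    + extensionality r; extensionality n; unfold e'.
      destruct (e r n) as [x Hx]; apply subset_eq_compat, Hx.
Qed.

(** Induction and choice are schemes with free parameters, whereas the completeness proof wants
    axioms invariant under substitution. The closed theorems are invariant, and derivations from
    them unfold into derivations from [T]. *)
Definition closed_theorem (T : fm -> Prop) (A : fm) : Prop :=
  proves T A /\ forall s, fsub s A = A.

Corollary completeness_closed (T : fm -> Prop) (A : fm) :
  (forall B, equality_axioms B -> proves T B) ->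
  (forall M, normal M -> models M (closed_theorem T) -> forall e : env M, sat e A) ->
  proves T A.
Proof.
  intros Heq H; apply prv_trans with (closed_theorem T); [now intros B []|].
  apply completeness; [now intros B []| |exact H].
  intros B HB; split; [now apply Heq|].
  destruct HB; apply sentence_closed; below.
Qed.

(** * Closed theorems of the system *)

Lemma ax_rca A : RCA0w A -> proves ACA0w_DeltaCA A.
Proof. intros H; now apply prv_ax; left; left. Qed.

Lemma ax_eq A : equality_axioms A -> proves ACA0w_DeltaCA A.
Proof.
  intros H; apply ax_rca; destruct H.
  - apply rca_semiring, osr_eq_refl.
  - apply rca_semiring, osr_eq_sym.
  - apply rca_semiring, osr_eq_trans.
  - apply rca_semiring, osr_eq_lt.
  - apply rca_ext.
Qed.

(** This one closed sentence accounts for all later inductions: a predicate with a characteristic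
    function holds everywhere iff that function agrees with the constant 1. *)
Definition ind_eq : fm := All N1 (All N1 (induction
  (Eq0 (App (Var N1 0) (Var N0 0)) (App (Var N1 1) (Var N0 0))))).

Lemma ind_eq_theorem : closed_theorem ACA0w_DeltaCA ind_eq.
Proof.
  split; [|reflexivity]. apply prv_all_i, prv_all_i, prv_ax; left; left.
  now apply rca_ind.
Qed.

(** The choice axiom takes an argument of type 1, so the two numbers to be compared are packed as
    the values of one function at 0 and 1. *)
Definition char_fm (C : tm N0 -> tm N0 -> fm) : fm :=
  let c := C (App (Var N1 0) Zero) (App (Var N1 0) One) in
  And (Imp c (Eq0 (Var N0 0) One)) (Imp (Neg c) (Eq0 (Var N0 0) Zero)).

Lemma char_eq_theorem : closed_theorem ACA0w_DeltaCA (ac10 (char_fm Eq0)).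
Proof. split; [|reflexivity]. apply ax_rca, rca_ac; simpl; tauto. Qed.

Lemma char_lt_theorem : closed_theorem ACA0w_DeltaCA (ac10 (char_fm Lt0)).
Proof. split; [|reflexivity]. apply ax_rca, rca_ac; simpl; tauto. Qed.

(** * Definable functions in a model *)

Declare Scope model_scope.
Delimit Scope model_scope with M.

Section Model.
Variable M : structure.
Hypothesis M_normal : normal M.
Hypothesis M_models : models M (closed_theorem ACA0w_DeltaCA).

Notation D := (dom M).
Notation N := (dom M N0).
Notation "f $ x" := (ap f x) (at level 11, left associativity) : model_scope.
Local Open Scope model_scope.

Definition add (x y : N) : N := plus $ x $ y.
Definition mul (x y : N) : N := times $ x $ y.
Notation "0" := (@zero M) : model_scope.
Notation "1" := (@one M) : model_scope.
Infix "+" := add : model_scope.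
Infix "*" := mul : model_scope.
Notation "x < y" := (lt0 x y) : model_scope.

Lemma eq0_eq (x y : N) : eq0 x y <-> x = y.
Proof. apply M_normal. Qed.

Lemma fun_ext s t (f g : D (s ~> t)) : (forall x, f $ x = g $ x) -> f = g.
Proof. apply M_normal. Qed.

Lemma eqm_eq t (x y : D t) : eqm t x y <-> x = y.
Proof.
  induction t as [|r _ s IH]; [apply eq0_eq|]. simpl; split.
  - intros H; apply fun_ext; intros z; now apply IH.
  - intros -> z; now apply IH.
Qed.

(** Every type is inhabited by a constant functional. This environment evaluates closed sentences
    and also supplies default values. *)
Definition e0 : env M := fun t _ =>
  (fix inhab t : D t :=
     match t with N0 => zero | Arr r s => pi s r $ inhab s end) t.

Lemma sat_means (A : Fm) (P : Prop) :
  closed_theorem ACA0w_DeltaCA (sentence A) -> means (e0, fun _ => O) A P -> P.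
Proof. intros H HP; apply (sat_sentence e0 A P HP), M_models, H. Qed.

Lemma sat_rca (A : Fm) (P : Prop) :
  RCA0w (sentence A) -> fm_below (fun _ => O) A -> means (e0, fun _ => O) A P -> P.
Proof.
  intros H HA; apply sat_means. split; [now apply ax_rca|now apply sentence_closed].
Qed.

Lemma sat_osr (A : Fm) (P : Prop) :
  ordered_semiring A -> fm_below (fun _ => O) A -> means (e0, fun _ => O) A P -> P.
Proof. intros H; apply sat_rca; now apply rca_semiring. Qed.

Lemma pi_eq s t (x : D s) (y : D t) : pi s t $ x $ y = x.
Proof.
  apply eqm_eq; revert x y.
  refine (sat_rca _ _ (rca_Pi s t) _ _); [below|mean].
Qed.

Lemma sigma_eq r s t (x : D (r ~> s ~> t)) (y : D (r ~> s)) (z : D r) :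
  sigma r s t $ x $ y $ z = x $ z $ (y $ z).
Proof.
  apply eqm_eq; revert x y z.
  refine (sat_rca _ _ (rca_Sigma r s t) _ _); [below|mean].
Qed.

Lemma rec_0 f (m : N) : rec $ f $ m $ 0 = m.
Proof.
  apply eq0_eq; revert f m. refine (sat_rca _ _ rca_Rec0 _ _); [below|mean].
Qed.

Lemma rec_S f (m n : N) : rec $ f $ m $ (n + 1) = f $ n $ (rec $ f $ m $ n).
Proof.
  apply eq0_eq; revert f m n. refine (sat_rca _ _ rca_RecS _ _); [below|mean].
Qed.

Lemma addA (x y z : N) : x + (y + z) = (x + y) + z.
Proof.
  apply eq0_eq; revert x y z. refine (sat_osr _ _ osr_addA _ _); [below|mean].
Qed.

Lemma addC (x y : N) : x + y = y + x.
Proof.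
  apply eq0_eq; revert x y. refine (sat_osr _ _ osr_addC _ _); [below|mean].
Qed.

Lemma add0 (x : N) : x + 0 = x.
Proof.
  apply eq0_eq; revert x. refine (sat_osr _ _ osr_add0 _ _); [below|mean].
Qed.

Lemma mulA (x y z : N) : x * (y * z) = (x * y) * z.
Proof.
  apply eq0_eq; revert x y z. refine (sat_osr _ _ osr_mulA _ _); [below|mean].
Qed.

Lemma mulC (x y : N) : x * y = y * x.
Proof.
  apply eq0_eq; revert x y. refine (sat_osr _ _ osr_mulC _ _); [below|mean].
Qed.

Lemma mul1 (x : N) : x * 1 = x.
Proof.
  apply eq0_eq; revert x. refine (sat_osr _ _ osr_mul1 _ _); [below|mean].
Qed.

Lemma mul0 (x : N) : x * 0 = 0.
Proof.
  apply eq0_eq; revert x. refine (sat_osr _ _ osr_mul0 _ _); [below|mean].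
Qed.

Lemma mulD (x y z : N) : x * (y + z) = x * y + x * z.
Proof.
  apply eq0_eq; revert x y z. refine (sat_osr _ _ osr_mulD _ _); [below|mean].
Qed.

Lemma lt_irrefl (x : N) : ~ x < x.
Proof. revert x. refine (sat_osr _ _ osr_lt_irrefl _ _); [below|mean]. Qed.

Lemma lt_trans (x y z : N) : x < y -> y < z -> x < z.
Proof. revert x y z. refine (sat_osr _ _ osr_lt_trans _ _); [below|mean]. Qed.

Lemma lt_total (x y : N) : x < y \/ x = y \/ y < x.
Proof.
  rewrite <- eq0_eq. revert x y. refine (sat_osr _ _ osr_lt_total _ _); [below|mean].
Qed.

Lemma lt_0_1 : 0 < 1.
Proof. refine (sat_osr _ _ osr_lt01 _ _); [below|mean]. Qed.

Lemma lt_add (x y z : N) : x < y -> x + z < y + z.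
Proof. revert x y z. refine (sat_osr _ _ osr_lt_add _ _); [below|mean]. Qed.

Lemma lt_mul (x y z : N) : x < y -> 0 < z -> x * z < y * z.
Proof. revert x y z. refine (sat_osr _ _ osr_lt_mul _ _); [below|mean]. Qed.

Lemma N_semiring : semi_ring_theory 0 1 add mul (@eq N).
Proof.
  constructor; intros.
  - now rewrite addC, add0.
  - apply addC.
  - apply addA.
  - now rewrite mulC, mul1.
  - now rewrite mulC, mul0.
  - apply mulC.
  - apply mulA.
  - now rewrite mulC, mulD, (mulC p n), (mulC p m).
Qed.

Add Ring N_ring : N_semiring.

Lemma ind_fun (f g : D N1) : f $ 0 = g $ 0 ->
  (forall n, f $ n = g $ n -> f $ (n + 1) = g $ (n + 1)) -> forall n, f $ n = g $ n.
Proof.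
  intros H0 HS n.
  assert (H := M_models _ ind_eq_theorem e0 g f).
  cbn in H. setoid_rewrite eq0_eq in H. exact (H H0 HS n).
Qed.

(** The model need not contain every map, so this is an abstraction only if [F] is definable.
    Choosing the element by [epsilon] makes it depend on the map alone: the body can be rewritten by
    extensionality, and no proof of definability enters the term. *)
Definition Lam {s t : ty} (F : D s -> D t) : D (s ~> t) :=
  epsilon (inhabits (e0 _ O)) (fun f => forall x, f $ x = F x).

Fixpoint ctx (c : list ty) : Type :=
  match c with nil => unit | cons t c => (D t * ctx c)%type end.

Fixpoint curried (c : list ty) (t : ty) : ty :=
  match c with nil => t | cons r c => curried c (r ~> t) end.

Fixpoint aps (c : list ty) (t : ty) : D (curried c t) -> ctx c -> D t :=
  match c with
  | nil => fun f _ => f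
  | cons r c => fun f e => aps c (r ~> t) f (snd e) $ fst e
  end.

(** Definability with parameters from the model: some element, applied to the entries of the context
    starting with the last one in the list, computes [F]. The combinators make these maps closed
    under abstraction. *)
Definition Def (c : list ty) {t : ty} (F : ctx c -> D t) : Prop :=
  exists f, forall e, aps c t f e = F e.

Lemma Def_ext c t (F G : ctx c -> D t) : (forall e, F e = G e) -> Def c F -> Def c G.
Proof. intros H [f Hf]; exists f; intros e; now rewrite Hf. Qed.

Lemma Def_const c t (x : D t) : Def c (fun _ => x).
Proof.
  revert t x; induction c as [|r c IH]; intros t x; [now exists x|].
  destruct (IH (r ~> t)%ty (pi t r $ x)) as [f Hf]; exists f; intros [y e].
  simpl; now rewrite Hf, pi_eq.
Qed.

Lemma Def_ap c s t (F : ctx c -> D (s ~> t)) (G : ctx c -> D s) :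
  Def c F -> Def c G -> Def c (fun e => F e $ G e).
Proof.
  revert s t F G; induction c as [|r c IH]; intros s t F G [f Hf] [g Hg].
  - exists (f $ g); intros e; simpl; now rewrite <- Hf, <- Hg.
  - destruct (IH _ _ (fun e => sigma r s t $ aps c (r ~> s ~> t)%ty f e) (aps c (r ~> s)%ty g))
      as [h Hh].
    + apply IH; [apply Def_const|now exists f].
    + now exists g.
    + exists h; intros e; simpl; rewrite Hh, sigma_eq, <- Hf, <- Hg; reflexivity.
Qed.

Lemma Def_weak c r t (F : ctx c -> D t) : Def c F -> Def (r :: c) (fun e => F (snd e)).
Proof.
  intros H; destruct (Def_ap c _ _ (fun _ => pi t r) F) as [f Hf]; [apply Def_const|exact H|].
  exists f; intros e; simpl; now rewrite Hf, pi_eq.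
Qed.

Lemma Def_var0 c r : Def (r :: c) (fun e => fst e).
Proof.
  destruct (Def_const c _ (sigma r (r ~> r)%ty r $ pi r (r ~> r)%ty $ pi r r)) as [f Hf].
  exists f; intros e; simpl; now rewrite Hf, sigma_eq, pi_eq.
Qed.

Lemma beta s t (F : D s -> D t) (x : D s) :
  Def (s :: nil) (fun e => F (fst e)) -> Lam F $ x = F x.
Proof.
  intros [f Hf]; revert x.
  apply (epsilon_spec (inhabits (e0 (s ~> t)%ty O)) (fun f => forall x, f $ x = F x)).
  exists f; intros x; exact (Hf (x, tt)).
Qed.

(** The element that defines the map with one more variable also defines the abstraction: that
    variable is its last argument, which is simply withheld. *)
Lemma Def_lam c s t (F : ctx c -> D s -> D t) :
  Def (s :: c) (fun e => F (snd e) (fst e)) -> Def c (fun e => Lam (F e)).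
Proof.
  intros [f Hf]; exists f; intros e; apply fun_ext; intros x.
  rewrite (Hf (x, e) : aps c (s ~> t)%ty f e $ x = F e x).
  symmetry; apply beta. exists (aps c (s ~> t)%ty f e); intros [y []]; exact (Hf (y, e)).
Qed.

Lemma Def_add c F G : Def c F -> Def c G -> Def c (fun e => F e + G e).
Proof. intros; unfold add; apply Def_ap; [apply Def_ap; [apply Def_const|]|]; easy. Qed.

Lemma Def_mul c F G : Def c F -> Def c G -> Def c (fun e => F e * G e).
Proof. intros; unfold mul; apply Def_ap; [apply Def_ap; [apply Def_const|]|]; easy. Qed.

(** Any single proposition has a truth value in the model; the content lies in the definability of a
    family of them, which says that a predicate has a characteristic functional. *)
Definition b2n (P : Prop) : N := if excluded_middle_informative P then 1 else 0.

Lemma neq_0_1 : (0 : N) <> 1.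
Proof. intros E; apply (lt_irrefl 0); rewrite E at 2; apply lt_0_1. Qed.

Lemma b2n_true (P : Prop) : P -> b2n P = 1.
Proof. unfold b2n; now destruct excluded_middle_informative. Qed.

Lemma b2n_false (P : Prop) : ~ P -> b2n P = 0.
Proof. unfold b2n; now destruct excluded_middle_informative. Qed.

Lemma b2n_1 (P : Prop) : b2n P = 1 <-> P.
Proof.
  split; [|apply b2n_true]. intros H; apply NNPP; intros HP.
  rewrite b2n_false in H by easy. now apply neq_0_1.
Qed.

Lemma b2n_0 (P : Prop) : b2n P = 0 <-> ~ P.
Proof.
  split; [|apply b2n_false]. intros H HP.
  rewrite b2n_true in H by easy. now apply neq_0_1.
Qed.

Lemma b2n_01 (P : Prop) : b2n P = 0 \/ b2n P = 1.
Proof. destruct (classic P); [right; now apply b2n_true|left; now apply b2n_false]. Qed.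

Lemma b2n_iff (P Q : Prop) : (P <-> Q) -> b2n P = b2n Q.
Proof. intros H; now replace P with Q by (apply propositional_extensionality; tauto). Qed.

Lemma sat_And (e : env M) A B : sat e (And A B) <-> sat e A /\ sat e B.
Proof. simpl; split; [|tauto]. intros H; apply NNPP; tauto. Qed.

Lemma sat_Ex (e : env M) t A : sat e (Ex t A) <-> exists x : D t, sat (econs x e) A.
Proof. simpl; split; [apply not_all_not_ex|firstorder]. Qed.

Lemma b2n_unique (P : Prop) (y : N) : (P -> y = 1) -> (~ P -> y = 0) -> y = b2n P.
Proof.
  intros H1 H0; destruct (classic P) as [HP|HP].
  - now rewrite b2n_true, H1.
  - now rewrite b2n_false, H0.
Qed.

(* QF-AC provides the characteristic functions of the prime formulas. *)
Lemma char_ex (C : tm N0 -> tm N0 -> fm) (R : N -> N -> Prop) :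
  closed_theorem ACA0w_DeltaCA (ac10 (char_fm C)) ->
  (forall s a b, fsub s (C a b) = C (tsub s a) (tsub s b)) ->
  (forall (e : env M) a b, sat e (C a b) <-> R (eval e a) (eval e b)) ->
  exists E : D (N0 ~> N0 ~> N0), forall x y, E $ x $ y = b2n (R x y).
Proof.
  intros HC Hsub HR.
  assert (H : exists Y : D N2, forall x : D N1, Y $ x = b2n (R (x $ 0) (x $ 1))).
  - assert (HC' := M_models _ HC e0).
    unfold ac10 in HC'; cbn [sat] in HC'; rewrite sat_Ex in HC'.
    destruct HC' as [Y HY].
    + intros x; rewrite sat_Ex; exists (b2n (R (x $ 0) (x $ 1))).
      unfold char_fm, Neg; rewrite sat_And; cbn [sat]; rewrite HR; cbn; rewrite !eq0_eq.
      split; [apply b2n_true|apply b2n_false].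
    + exists Y; intros x.
      assert (E : fsub (scons (App (Var N2 0) (Var N1 0)) (shift N2)) (char_fm C) = And
        (Imp (C (App (Var N1 0) Zero) (App (Var N1 0) One))
           (Eq0 (App (Var N2 0) (Var N1 0)) One))
        (Imp (Neg (C (App (Var N1 0) Zero) (App (Var N1 0) One)))
           (Eq0 (App (Var N2 0) (Var N1 0)) Zero))).
      { unfold char_fm, And, Neg; simpl; now rewrite Hsub. }
      rewrite E in HY; specialize (HY x).
      change (sat (econs x (econs Y e0)) (And
        (Imp (C (App (Var N1 0) Zero) (App (Var N1 0) One))
           (Eq0 (App (Var N2 0) (Var N1 0)) One))
        (Imp (Neg (C (App (Var N1 0) Zero) (App (Var N1 0) One)))
           (Eq0 (App (Var N2 0) (Var N1 0)) Zero)))) in HY.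
      rewrite sat_And in HY; unfold Neg in HY; cbn [sat] in HY; rewrite HR in HY.
      cbn in HY; rewrite !eq0_eq in HY. now apply b2n_unique.
  - destruct H as [Y HY].
    (* The function with value [x] at 0 and [y] at all successors. *)
    pose (two := fun x y : N => rec $ Lam (fun _ => Lam (fun _ => y)) $ x).
    assert (Hd : forall c F G, Def c F -> Def c G -> Def c (fun e => two (F e) (G e))).
    { intros c F G HF HG; apply Def_ap; [|exact HF].
      apply Def_ap; [apply Def_const|]. apply Def_lam, Def_lam.
      now apply Def_weak with (F := fun e => G (snd e)), Def_weak. }
    exists (Lam (fun x => Lam (fun y => Y $ two x y))); intros x y.
    rewrite beta, beta.
    + rewrite HY; unfold two; rewrite rec_0.
      replace (1 : N) with ((0 : N) + 1) at 1 by ring.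
      rewrite rec_S, !beta; [easy| |]; apply Def_const || apply Def_lam, Def_const.
    + apply Def_ap; [apply Def_const|]. apply Hd; [apply Def_const|apply Def_var0].
    + apply Def_lam, Def_ap; [apply Def_const|]. apply Hd; [exact (Def_weak _ _ _ _ (Def_var0 _ _))|apply Def_var0].
Qed.

Lemma Def_eq c (F G : ctx c -> N) : Def c F -> Def c G -> Def c (fun e => b2n (F e = G e)).
Proof.
  intros HF HG; destruct (char_ex Eq0 eq char_eq_theorem) as [E HE].
  - reflexivity.
  - intros; apply eq0_eq.
  - apply Def_ext with (fun e => E $ F e $ G e); [auto|].
    now apply Def_ap; [apply Def_ap; [apply Def_const|]|].
Qed.

Lemma Def_lt c (F G : ctx c -> N) : Def c F -> Def c G -> Def c (fun e => b2n (F e < G e)).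
Proof.
  intros HF HG; destruct (char_ex Lt0 lt0 char_lt_theorem) as [E HE].
  - reflexivity.
  - reflexivity.
  - apply Def_ext with (fun e => E $ F e $ G e); [auto|].
    now apply Def_ap; [apply Def_ap; [apply Def_const|]|].
Qed.

Lemma Def_iff c (P Q : ctx c -> Prop) : (forall e, P e <-> Q e) ->
  Def c (fun e => b2n (P e)) -> Def c (fun e => b2n (Q e)).
Proof. intros H; apply Def_ext; intros e; now apply b2n_iff. Qed.

Lemma Def_not c (P : ctx c -> Prop) :
  Def c (fun e => b2n (P e)) -> Def c (fun e => b2n (~ P e)).
Proof.
  intros H; apply Def_iff with (fun e => b2n (P e) = 0); [intros; apply b2n_0|].
  apply Def_eq; [exact H|apply Def_const].
Qed.

Lemma Def_and c (P Q : ctx c -> Prop) : Def c (fun e => b2n (P e)) ->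
  Def c (fun e => b2n (Q e)) -> Def c (fun e => b2n (P e /\ Q e)).
Proof.
  intros HP HQ; apply Def_ext with (fun e => b2n (P e) * b2n (Q e)); [|now apply Def_mul].
  intros e; apply b2n_unique; [intros []; rewrite !b2n_true by easy; ring|].
  intros H; destruct (classic (P e)).
  - rewrite (b2n_false (Q e)) by tauto; ring.
  - rewrite b2n_false by easy; ring.
Qed.

Lemma Def_imp c (P Q : ctx c -> Prop) : Def c (fun e => b2n (P e)) ->
  Def c (fun e => b2n (Q e)) -> Def c (fun e => b2n (P e -> Q e)).
Proof.
  intros HP HQ; apply Def_iff with (fun e => ~ (P e /\ ~ Q e)).
  - intros e; split; [|tauto]. intros; apply NNPP; tauto.
  - now apply Def_not, Def_and, Def_not.
Qed.

Lemma Def_or c (P Q : ctx c -> Prop) : Def c (fun e => b2n (P e)) ->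
  Def c (fun e => b2n (Q e)) -> Def c (fun e => b2n (P e \/ Q e)).
Proof.
  intros HP HQ; apply Def_iff with (fun e => ~ P e -> Q e).
  - intros e; split; [|tauto]. destruct (classic (P e)); tauto.
  - now apply Def_imp; [apply Def_not|].
Qed.

(** * Number quantifiers, arithmetical induction and least elements *)

Lemma mu_ex : exists mu : D N2, forall f : D N1,
  ((exists n, f $ n = 0) -> f $ (mu $ f) = 0 /\ forall i, i < mu $ f -> ~ f $ i = 0) /\
  ((forall n, ~ f $ n = 0) -> mu $ f = 0).
Proof.
  setoid_rewrite <- eq0_eq; apply (sat_means mu2); [|unfold mu2; mean].
  split; [|apply sentence_closed; unfold mu2; below].
  apply prv_ax; left; now right.
Qed.

Definition mu : D N2 := proj1_sig (constructive_indefinite_description _ mu_ex).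

Lemma mu_spec (f : D N1) : (exists n, f $ n = 0) ->
  f $ (mu $ f) = 0 /\ forall i, i < mu $ f -> ~ f $ i = 0.
Proof. unfold mu; destruct constructive_indefinite_description as [m Hm]; apply Hm. Qed.

(** The characteristic function of [P e], evaluated where [mu] looks for a zero of it, gives 0 if
    there is a counterexample and 1 otherwise. *)
Lemma Def_forall c (P : ctx c -> N -> Prop) :
  Def (N0 :: c) (fun e => b2n (P (snd e) (fst e))) ->
  Def c (fun e => b2n (forall n, P e n)).
Proof.
  intros H; pose (f e := Lam (fun n => b2n (P e n))).
  assert (Hf : forall e n, f e $ n = b2n (P e n)).
  { intros e n; unfold f; apply beta with (F := fun n => b2n (P e n)).
    destruct H as [g Hg].
    exists (aps c (N0 ~> N0)%ty g e); intros [m []]; exact (Hg (m, e)). }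
  apply Def_ext with (fun e => f e $ (mu $ f e)).
  - intros e; apply b2n_unique.
    + intros HP; rewrite Hf; now apply b2n_true.
    + intros HP; apply mu_spec. apply not_all_ex_not in HP; destruct HP as [n Hn].
      exists n; rewrite Hf; now apply b2n_false.
  - apply Def_ap; [|apply Def_ap; [apply Def_const|]]; now apply Def_lam.
Qed.

Lemma Def_exists c (P : ctx c -> N -> Prop) :
  Def (N0 :: c) (fun e => b2n (P (snd e) (fst e))) ->
  Def c (fun e => b2n (exists n, P e n)).
Proof.
  intros H; apply Def_iff with (fun e => ~ forall n, ~ P e n).
  - intros e; split; [apply not_all_not_ex|firstorder].
  - now apply Def_not, Def_forall, Def_not.
Qed.

(** The map ignores the first variable; a default value put in its place lets it be read over the
    shorter context. *)
Ltac def_weak :=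
  lazymatch goal with
  | |- Def (?r :: ?c) ?f =>
      let g := eval cbn [fst snd] in (fun e => f (e0 r O, e)) in
      refine (Def_weak c r _ g _)
  end.

(** An extension point, redefined whenever further operations have to be unfolded in proofs of
    definability. *)
Ltac def_hook := idtac.

Ltac def :=
  cbv beta;
  lazymatch goal with
  | |- Def _ (fun _ => ?a) => apply Def_const
  | |- Def _ fst => apply Def_var0
  | |- Def _ (fun e => fst e) => apply Def_var0
  | |- Def _ (fun e => fst _) => def_weak; def
  | |- Def _ (fun e => ap _ _) => refine (Def_ap _ _ _ _ _ _ _); def
  | |- Def _ (fun e => add _ _) => refine (Def_add _ _ _ _ _); def
  | |- Def _ (fun e => mul _ _) => refine (Def_mul _ _ _ _ _); def
  | |- Def _ (fun e => Lam _) => refine (Def_lam _ _ _ _ _); def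
  | |- Def _ (fun e => b2n (_ = _)) => refine (Def_eq _ _ _ _ _); def
  | |- Def _ (fun e => b2n (lt0 _ _)) => refine (Def_lt _ _ _ _ _); def
  | |- Def _ (fun e => b2n (_ /\ _)) => refine (Def_and _ _ _ _ _); def
  | |- Def _ (fun e => b2n (_ \/ _)) => refine (Def_or _ _ _ _ _); def
  | |- Def _ (fun e => b2n (~ _)) => refine (Def_not _ _ _); def
  | |- Def _ (fun e => b2n (exists n, _)) => refine (Def_exists _ _ _); def
  | |- Def _ (fun e => b2n (forall n : N, _)) => refine (Def_forall _ _ _); def
  | |- Def _ (fun e => b2n (_ -> _)) => refine (Def_imp _ _ _ _ _); def
  | |- _ => def_hook
  end.

(** Since number quantifiers are definable through [mu], quantifier-free induction extends to all
    arithmetical predicates with parameters. *)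
Lemma ind (P : N -> Prop) : Def (N0 :: nil) (fun e => b2n (P (fst e))) ->
  P 0 -> (forall n, P n -> P (n + 1)) -> forall n, P n.
Proof.
  intros HP H0 HS n; apply b2n_1.
  assert (H : forall n, Lam (fun n => b2n (P n)) $ n = Lam (fun _ : N => 1 : N) $ n).
  - apply ind_fun; intros; rewrite !beta in * by (exact HP || def);
      apply b2n_1; [easy|]. apply HS, b2n_1; easy.
  - specialize (H n); now rewrite !beta in H by (exact HP || def).
Qed.

Ltac induct n := pattern n; refine (ind _ _ _ _ n); [def|cbv beta|cbv beta; clear n].

(** The negation is there because [mu] searches for zeros. *)
Definition least (P : N -> Prop) : N := mu $ Lam (fun n => b2n (~ P n)).

Lemma least_spec (P : N -> Prop) : Def (N0 :: nil) (fun e => b2n (P (fst e))) ->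
  (exists n, P n) -> P (least P) /\ forall n, n < least P -> ~ P n.
Proof.
  intros HP [n Hn]; assert (HP' := Def_not _ _ HP).
  assert (E : forall n, Lam (fun n => b2n (~ P n)) $ n = 0 <-> P n).
  { intros m; rewrite beta by exact HP'. rewrite b2n_0; split; [apply NNPP|tauto]. }
  destruct (mu_spec (Lam (fun n => b2n (~ P n)))) as [H1 H2].
  - exists n; now apply E.
  - split; [now apply E|]. intros m Hm Hm'; apply (H2 m Hm), E, Hm'.
Qed.

(** * Arithmetic *)

Lemma add0l (x : N) : 0 + x = x.
Proof. ring. Qed.

Lemma zero_or_succ (n : N) : n = 0 \/ exists m, n = m + 1.
Proof. induct n; [now left|]. intros m _; right; now exists m. Qed.

Lemma lt_succ_pos (n : N) : 0 < n + 1.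
Proof.
  induct n; [rewrite add0l; apply lt_0_1|].
  intros m H; apply lt_trans with (m + 1); [easy|].
  assert (H' := lt_add _ _ (m + 1) lt_0_1).
  now rewrite add0l, (addC 1) in H'.
Qed.

Lemma nlt_0 (x : N) : ~ x < 0.
Proof.
  destruct (zero_or_succ x) as [->|[m ->]]; [apply lt_irrefl|].
  intros H; apply (lt_irrefl 0), lt_trans with (m + 1); [apply lt_succ_pos|easy].
Qed.

Lemma lt_add_iff (x y z : N) : x + z < y + z <-> x < y.
Proof.
  split; [|apply lt_add]. intros H.
  destruct (lt_total x y) as [E|[->|E]]; [easy|now apply lt_irrefl in H|].
  exfalso; apply (lt_irrefl (x + z)); eapply lt_trans; [exact H|now apply lt_add].
Qed.

Lemma add_cancel (x y z : N) : x + z = y + z -> x = y.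
Proof.
  intros H; destruct (lt_total x y) as [E|[E|E]]; [|easy|];
    apply (lt_add _ _ z) in E; rewrite H in E; now apply lt_irrefl in E.
Qed.

(** The ordered semiring axioms also hold in the nonnegative rationals; discreteness of the order
    comes from induction. *)
Lemma lt_diff (x y : N) : x < y <-> exists z, y = x + z + 1.
Proof.
  split.
  - revert x; intros x; assert (H : forall y x, x < y -> exists z, y = x + z + 1); [|apply H].
    clear x y; intros y; induct y.
    + intros x H; now apply nlt_0 in H.
    + intros y IH x H; destruct (zero_or_succ x) as [->|[m ->]].
      * exists y; ring.
      * apply lt_add_iff, IH in H; destruct H as [z ->]; exists z; ring.
  - intros [z ->]. replace (x + z + 1) with (z + 1 + x) by ring.
    rewrite <- (add0l x) at 1; apply lt_add, lt_succ_pos.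
Qed.

Lemma lt_succ_r (x y : N) : x < y + 1 <-> x < y \/ x = y.
Proof.
  split.
  - rewrite !lt_diff; intros [z H].
    assert (E : y = x + z) by (apply (add_cancel _ _ 1); now rewrite H).
    destruct (zero_or_succ z) as [->|[m ->]].
    + right; rewrite E; ring.
    + left; exists m; rewrite E; ring.
  - intros [H|<-]; rewrite lt_diff.
    + apply lt_diff in H; destruct H as [z ->]; exists (z + 1); ring.
    + exists 0; ring.
Qed.

Lemma nlt_le (x y : N) : ~ x < y -> exists z, x = y + z.
Proof.
  intros H; destruct (lt_total x y) as [E|[->|E]]; [easy|exists 0; ring|].
  apply lt_diff in E; destruct E as [z ->]; exists (z + 1); ring.
Qed.

Lemma lt_mul_iff (x y z : N) : x * (z + 1) < y * (z + 1) <-> x < y.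
Proof.
  split; [|intros H; apply lt_mul; [easy|apply lt_succ_pos]].
  intros H; destruct (lt_total x y) as [E|[->|E]]; [easy|now apply lt_irrefl in H|].
  exfalso; apply (lt_irrefl (x * (z + 1))); eapply lt_trans; [exact H|].
  apply lt_mul; [easy|apply lt_succ_pos].
Qed.

Lemma mul_cancel (x y z : N) : x * (z + 1) = y * (z + 1) -> x = y.
Proof.
  intros H; destruct (lt_total x y) as [E|[E|E]]; [|easy|];
    apply (lt_mul_iff _ _ z) in E; rewrite H in E; now apply lt_irrefl in E.
Qed.

(** * Finite sums *)

(** The sum is an element of the model because its length may be nonstandard and because sums must
    stay definable in their parameters. *)
Definition sumE : D (N1 ~> N0 ~> N0) :=
  Lam (fun f : D N1 => rec $ Lam (fun i : N => Lam (fun r : N => r + f $ i)) $ 0).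
Notation "\sum_ ( i < n ) F" := (sumE $ Lam (fun i : N => F) $ n)
  (at level 41, F at level 41, i name, n at level 36, format "\sum_ ( i  <  n )  F") : model_scope.

Lemma sum_0 (f : D N1) : sumE $ f $ 0 = 0.
Proof. unfold sumE; rewrite beta by def; apply rec_0. Qed.

Lemma sum_S (f : D N1) (n : N) : sumE $ f $ (n + 1) = sumE $ f $ n + f $ n.
Proof. unfold sumE; rewrite beta by def. rewrite rec_S, !beta by def; reflexivity. Qed.

Lemma sum_eq (f g : D N1) (n : N) :
  (forall i, i < n -> f $ i = g $ i) -> sumE $ f $ n = sumE $ g $ n.
Proof.
  induct n; [intros _; now rewrite !sum_0|]. intros n IH H.
  rewrite !sum_S, IH, H; [easy|apply lt_succ_r; now right|].
  intros i Hi; apply H, lt_succ_r; now left.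
Qed.

Lemma sum_zero (f : D N1) (n : N) : (forall i, i < n -> f $ i = 0) -> sumE $ f $ n = 0.
Proof.
  induct n; [intros _; now rewrite sum_0|]. intros n IH H.
  rewrite sum_S, IH, H; [ring|apply lt_succ_r; now right|].
  intros i Hi; apply H, lt_succ_r; now left.
Qed.

Lemma sum_add (f g : D N1) (n : N) :
  \sum_(i < n) (f $ i + g $ i) = sumE $ f $ n + sumE $ g $ n.
Proof.
  induct n; [rewrite !sum_0; ring|]. intros n IH.
  rewrite !sum_S, IH, beta by def; ring.
Qed.

Lemma sum_scale (c : N) (f : D N1) (n : N) : \sum_(i < n) (c * f $ i) = c * sumE $ f $ n.
Proof.
  induct n; [rewrite !sum_0; ring|]. intros n IH.
  rewrite !sum_S, IH, beta by def; ring.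
Qed.

Lemma sum_swap (h : D (N0 ~> N0 ~> N0)) (n m : N) :
  \sum_(i < n) (sumE $ (h $ i) $ m) = \sum_(j < m) \sum_(i < n) (h $ i $ j).
Proof.
  induct n.
  - rewrite sum_0; symmetry; apply sum_zero; intros j _; rewrite beta by def; apply sum_0.
  - intros n IH. rewrite sum_S, IH, beta by def.
    rewrite <- sum_add; apply sum_eq; intros j _. rewrite !beta by def.
    now rewrite sum_S, beta by def.
Qed.

Lemma sum_extend (f : D N1) (n m : N) :
  (forall i, ~ i < n -> f $ i = 0) -> sumE $ f $ (n + m) = sumE $ f $ n.
Proof.
  intros H; induct m; [now rewrite add0|]. intros m IH.
  rewrite addA, sum_S, IH, H; [ring|].
  rewrite lt_diff; intros [z E]. apply (lt_irrefl n). rewrite E at 2.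
  apply lt_diff; exists (m + z); ring.
Qed.

Lemma sum_single (f : D N1) (n k : N) : k < n ->
  (forall i, i <> k -> f $ i = 0) -> sumE $ f $ n = f $ k.
Proof.
  intros Hk H; apply lt_diff in Hk; destruct Hk as [z ->].
  replace (k + z + 1) with (k + 1 + z) by ring.
  rewrite sum_extend, sum_S, sum_zero; [ring| |].
  - intros i Hi; apply H; intros ->; now apply lt_irrefl in Hi.
  - intros i Hi; apply H; intros ->; apply Hi, lt_succ_r; now right.
Qed.

(** * Parity *)

Definition Even (x : N) : Prop := exists y, x = y + y.

Lemma double_neq (y z : N) : y + y <> z + z + 1.
Proof.
  intros H. destruct (lt_total y z) as [E|[->|E]].
  - apply lt_diff in E; destruct E as [w ->].
    assert (E : 0 = w + w + 1 + 1 + 1) by (apply (add_cancel _ _ (y + y)); rewrite add0l; rewrite H at 1; ring).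
    apply (nlt_0 0); rewrite E at 2. apply lt_succ_pos.
  - assert (E : 0 = 1) by (apply (add_cancel _ _ (z + z)); rewrite add0l; rewrite H at 1; ring).
    now apply neq_0_1.
  - apply lt_diff in E; destruct E as [w ->].
    assert (E : w + w + 1 = 0) by (apply (add_cancel _ _ (z + z + 1)); rewrite add0l; rewrite <- H at 2; ring).
    apply (nlt_0 0); rewrite <- E at 2. apply lt_succ_pos.
Qed.

Lemma even_or_odd (x : N) : Even x \/ exists y, x = y + y + 1.
Proof.
  unfold Even; induct x; [left; exists 0; ring|].
  intros x [[y ->]|[y ->]].
  - right; now exists y.
  - left; exists (y + 1); ring.
Qed.

Lemma odd_iff (x : N) : ~ Even x <-> exists y, x = y + y + 1.
Proof.
  split.
  - destruct (even_or_odd x); tauto.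
  - intros [y ->] [z E]; symmetry in E; now apply double_neq in E.
Qed.

Lemma even_0 : Even 0.
Proof. exists 0; ring. Qed.

Lemma even_double x : Even (x + x).
Proof. now exists x. Qed.

Lemma even_add x y : Even x -> Even y -> Even (x + y).
Proof. intros [a ->] [b ->]; exists (a + b); ring. Qed.

Lemma odd_add x y : Even x -> ~ Even y -> ~ Even (x + y).
Proof. rewrite !odd_iff; intros [a ->] [b ->]; exists (a + b); ring. Qed.

Lemma even_cancel x y : Even x -> Even (x + y) -> Even y.
Proof. intros Hx Hxy; apply NNPP; intros Hy; now apply (odd_add x y). Qed.

Lemma even_mul x y : Even x -> Even (x * y).
Proof. intros [a ->]; exists (a * y); ring. Qed.

Lemma odd_mul x y : ~ Even x -> ~ Even y -> ~ Even (x * y).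
Proof. rewrite !odd_iff; intros [a ->] [b ->]; exists (a * b + a * b + a + b); ring. Qed.

Lemma sum_even (f : D N1) (n : N) : (forall i, i < n -> Even (f $ i)) -> Even (sumE $ f $ n).
Proof.
  unfold Even; induct n; [rewrite sum_0; intros _; apply even_0|].
  intros n IH H; rewrite sum_S; apply even_add.
  - apply IH; intros i Hi; apply H, lt_succ_r; now left.
  - apply H, lt_succ_r; now right.
Qed.

Lemma sum_odd (f : D N1) (n k : N) : k < n -> ~ Even (f $ k) ->
  (forall i, i < n -> i <> k -> Even (f $ i)) -> ~ Even (sumE $ f $ n).
Proof.
  intros Hk Hf. unfold Even; revert Hk; induct n; [intros H; now apply nlt_0 in H|].
  intros n IH Hn H; rewrite sum_S. apply lt_succ_r in Hn; destruct Hn as [Hn| <-].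
  - rewrite addC; apply odd_add.
    + apply H; [apply lt_succ_r; now right|intros ->; now apply lt_irrefl in Hn].
    + apply IH; [easy|]. intros i Hi; apply H, lt_succ_r; now left.
  - apply odd_add; [|easy]. apply sum_even; intros i Hi; apply H.
    + apply lt_succ_r; now left.
    + intros ->; now apply lt_irrefl in Hi.
Qed.

Notation DefN F := (Def (N0 :: nil) (fun e => F (fst e))).

Lemma sum_eqF (F G : N -> N) (n : N) : DefN F -> DefN G ->
  (forall i, i < n -> F i = G i) -> \sum_(i < n) F i = \sum_(i < n) G i.
Proof.
  intros HF HG H; apply sum_eq; intros i Hi; rewrite !beta by assumption; auto.
Qed.

Lemma sum_scaleF (c : N) (F : N -> N) (n : N) : DefN F ->
  \sum_(i < n) (c * F i) = c * \sum_(i < n) F i.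
Proof.
  intros HF; rewrite <- sum_scale; apply sum_eqF.
  - refine (Def_mul _ _ _ _ HF); def.
  - refine (Def_mul _ _ _ _ _); [def|apply Def_ap; def].
  - intros i _; now rewrite beta.
Qed.

Lemma sum_addF (F G : N -> N) (n : N) : DefN F -> DefN G ->
  \sum_(i < n) (F i + G i) = \sum_(i < n) F i + \sum_(i < n) G i.
Proof.
  intros HF HG; rewrite <- sum_add; apply sum_eqF.
  - now apply Def_add.
  - apply Def_add; def.
  - intros i _; now rewrite !beta.
Qed.

Lemma sum_swapF (H : N -> N -> N) (n m : N) :
  Def (N0 :: N0 :: nil) (fun e => H (fst (snd e)) (fst e)) ->
  \sum_(i < n) \sum_(j < m) H i j = \sum_(j < m) \sum_(i < n) H i j.
Proof.
  intros HH; pose (h := Lam (fun i => Lam (fun j => H i j))).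
  assert (H1 : forall i, h $ i = Lam (fun j => H i j)).
  { intros i; apply beta with (F := fun i => Lam (fun j => H i j)).
    apply Def_lam with (F := fun e j => H (fst e) j), HH. }
  assert (H2 : forall i, DefN (H i)).
  { destruct HH as [f Hf]; intros i; exists (aps (N0 :: nil) (N0 ~> N0)%ty f (i, tt)).
    intros [j []]; exact (Hf (j, (i, tt))). }
  replace (Lam (fun j => \sum_(i < n) H i j))
    with (Lam (fun j => \sum_(i < n) (h $ i $ j))).
  - rewrite <- sum_swap; do 2 f_equal; f_equal; extensionality i; now rewrite H1.
  - f_equal; extensionality j; do 3 f_equal; extensionality i; now rewrite H1, beta.
Qed.

Lemma sum_singleF (F : N -> N) (n k : N) : DefN F -> k < n ->
  (forall i, i <> k -> F i = 0) -> \sum_(i < n) F i = F k.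
Proof.
  intros HF Hk H; rewrite sum_single with (k := k); [now rewrite beta|easy|].
  intros i Hi; rewrite beta by easy; auto.
Qed.

Lemma sum_zeroF (F : N -> N) (n : N) : DefN F ->
  (forall i, i < n -> F i = 0) -> \sum_(i < n) F i = 0.
Proof. intros HF H; apply sum_zero; intros i Hi; rewrite beta by easy; auto. Qed.

(** * The Dirichlet ring *)

(* Multiplication of positive integers, on predecessors. *)
Notation "d # e" := (d * e + d + e) (at level 45, left associativity) : model_scope.

Lemma op_comm (d e : N) : d # e = e # d.
Proof. ring. Qed.

Lemma op_cancel (c d e : N) : c # d = c # e -> d = e.
Proof.
  intros H; apply (mul_cancel _ _ c), (add_cancel _ _ c).
  transitivity (c # d); [ring|]. rewrite H; ring.
Qed.

Lemma op_large (n d e : N) : ~ d < n + 1 -> d # e <> n.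
Proof.
  intros H E; apply nlt_le in H; destruct H as [z ->].
  apply (lt_irrefl n). rewrite <- E at 2. apply lt_diff.
  exists ((n + 1 + z) * e + z + e). ring.
Qed.

Lemma op_lt (c d e : N) : d < e -> c # d < c # e.
Proof.
  intros H; apply lt_diff in H; destruct H as [z ->].
  apply lt_diff; exists (c * z + c + z); ring.
Qed.

(** Index [n] stands for the integer [n + 1]. All pairs up to [n] are summed and an indicator
    selects those with the right product, so no division occurs and the ring laws reduce to
    exchanging sums. *)
Definition convE : D (N1 ~> N1 ~> N1) :=
  Lam (fun f : D N1 => Lam (fun g : D N1 => Lam (fun n : N =>
    \sum_(d < n + 1) \sum_(e < n + 1) (b2n (d # e = n) * (f $ d * g $ e))))).
Definition conv (f g : D N1) : D N1 := convE $ f $ g.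
Infix "**" := conv (at level 40, left associativity) : model_scope.

Lemma conv_def (f g : D N1) (n : N) : (f ** g) $ n =
  \sum_(d < n + 1) \sum_(e < n + 1) (b2n (d # e = n) * (f $ d * g $ e)).
Proof. unfold conv, convE; now rewrite !beta by def. Qed.

Lemma conv_bound (f g : D N1) (n B : N) : n < B -> (f ** g) $ n =
  \sum_(d < B) \sum_(e < B) (b2n (d # e = n) * (f $ d * g $ e)).
Proof.
  intros H; apply lt_diff in H; destruct H as [z ->].
  replace (n + z + 1) with (n + 1 + z) by ring.
  rewrite conv_def, (sum_extend _ (n + 1) z).
  - apply sum_eqF; [def|def|]. intros d _. rewrite (sum_extend _ (n + 1) z); [easy|].
    intros e He; rewrite beta by def.
    rewrite b2n_false; [ring|]. rewrite op_comm; now apply op_large.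
  - intros d Hd; rewrite beta by def. apply sum_zeroF; [def|]. intros e _.
    rewrite b2n_false; [ring|]. now apply op_large.
Qed.

Lemma conv_comm (f g : D N1) : f ** g = g ** f.
Proof.
  apply fun_ext; intros n; rewrite !conv_def, sum_swapF by def.
  apply sum_eqF; [def|def|]; intros e _; apply sum_eqF; [def|def|]; intros d _.
  rewrite (op_comm d e); ring.
Qed.

(** Summing a product against a weight [phi] distributes the weight over pairs. Pairs whose product
    reaches [B] are absent on the left and have weight 0 on the right. *)
Lemma conv_pair (f g phi : D N1) (B : N) : (forall k, ~ k < B -> phi $ k = 0) ->
  \sum_(k < B) (phi $ k * (f ** g) $ k) =
  \sum_(d < B) \sum_(e < B) (f $ d * g $ e * phi $ (d # e)).
Proof.
  intros H.
  transitivity (\sum_(k < B) \sum_(d < B) \sum_(e < B)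
    (phi $ k * (b2n (d # e = k) * (f $ d * g $ e)))).
  - apply sum_eqF; [unfold conv; def|def|]. intros k Hk; rewrite (conv_bound f g k B Hk).
    rewrite <- sum_scaleF by def. apply sum_eqF; [def|def|]. intros d _.
    now rewrite <- sum_scaleF by def.
  - rewrite sum_swapF by def. apply sum_eqF; [def|def|]; intros d _.
    rewrite sum_swapF by def. apply sum_eqF; [def|def|]; intros e _.
    destruct (classic (d # e < B)) as [HB|HB].
    + rewrite sum_singleF with (k := d # e); [rewrite b2n_true by easy; ring|def|easy|].
      intros i Hi; rewrite b2n_false by auto; ring.
    + rewrite H by easy. rewrite sum_zeroF; [ring|def|]. intros k _.
      destruct (classic (d # e = k)) as [<-|E]; [rewrite H by easy; ring|].
      rewrite b2n_false by easy; ring.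
Qed.

(** The triple sum is symmetric in the three factors, so associativity becomes a permutation of
    sums. *)
Lemma conv3 (f g h : D N1) (n : N) : ((f ** g) ** h) $ n =
  \sum_(d < n + 1) \sum_(e < n + 1) \sum_(c < n + 1)
    (b2n (d # e # c = n) * (f $ d * g $ e * h $ c)).
Proof.
  (* The weights that express the coefficient at [n] of a product with [h] as a linear form in the
     other factor. *)
  pose (phi := Lam (fun i => \sum_(c < n + 1) (b2n (i # c = n) * h $ c))).
  transitivity (\sum_(i < n + 1) (phi $ i * (f ** g) $ i)).
  - rewrite conv_def; apply sum_eqF; [unfold conv; def|unfold conv; def|]. intros i _.
    unfold phi; rewrite beta by def. rewrite mulC, <- sum_scaleF by def.
    apply sum_eqF; [def|def|]. intros c _; ring.
  - rewrite conv_pair.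
    + apply sum_eqF; [def|def|]; intros d _; apply sum_eqF; [def|def|]; intros e _.
      unfold phi; rewrite beta by def. rewrite <- sum_scaleF by def.
      apply sum_eqF; [def|def|]; intros c _; ring.
    + intros k Hk; unfold phi; rewrite beta by def. apply sum_zeroF; [def|].
      intros c _; rewrite b2n_false; [ring|now apply op_large].
Qed.

Lemma conv_assoc (f g h : D N1) : f ** (g ** h) = (f ** g) ** h.
Proof.
  apply fun_ext; intros n; rewrite (conv_comm f (g ** h)), !conv3.
  transitivity (\sum_(d < n + 1) \sum_(c < n + 1) \sum_(e < n + 1)
    (b2n (d # c # e = n) * (g $ d * h $ c * f $ e))); [easy|].
  transitivity (\sum_(d < n + 1) \sum_(e < n + 1) \sum_(c < n + 1)
    (b2n (d # c # e = n) * (g $ d * h $ c * f $ e))).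
  { apply sum_eqF; [def|def|]; intros d _; now rewrite sum_swapF by def. }
  rewrite sum_swapF by def.
  apply sum_eqF; [def|def|]; intros d _; apply sum_eqF; [def|def|]; intros e _.
  apply sum_eqF; [def|def|]; intros c _.
  replace (d # e # c) with (e # c # d) by ring. ring.
Qed.

Definition addE : D (N1 ~> N1 ~> N1) :=
  Lam (fun f : D N1 => Lam (fun g : D N1 => Lam (fun n => f $ n + g $ n))).
Definition cadd (f g : D N1) : D N1 := addE $ f $ g.
Infix "++" := cadd : model_scope.

Lemma cadd_def (f g : D N1) n : (f ++ g) $ n = f $ n + g $ n.
Proof. unfold cadd, addE; now rewrite !beta by def. Qed.

(** The monomial of the integer [c + 1]; in particular [delta 0] is the unit. *)
Definition deltaE : D (N0 ~> N1) := Lam (fun c : N => Lam (fun k => b2n (k = c))).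
Definition delta (c : N) : D N1 := deltaE $ c.

Lemma delta_def (c k : N) : delta c $ k = b2n (k = c).
Proof. unfold delta, deltaE; now rewrite !beta by def. Qed.

Definition cnull : D N1 := Lam (fun _ => 0).

Lemma cnull_def k : cnull $ k = 0.
Proof. unfold cnull; now rewrite beta by def. Qed.

(** By cancellation, [k] is the only index whose product with [c] is [c # k]. *)
Lemma conv_delta (c : N) (f : D N1) (k : N) : (delta c ** f) $ (c # k) = f $ k.
Proof.
  rewrite conv_def.
  assert (Hk : c < c # k + 1).
  { apply lt_diff; exists (c * k + k); ring. }
  assert (Hc : k < c # k + 1).
  { apply lt_diff; exists (c * k + c); ring. }
  rewrite sum_singleF with (k := c); [|unfold delta; def|easy|].
  - rewrite sum_singleF with (k := k); [|unfold delta; def|easy|].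
    + rewrite delta_def, !b2n_true by easy; ring.
    + intros e He. rewrite b2n_false; [ring|]. intros E; now apply op_cancel in E.
  - intros d Hd; apply sum_zeroF; [unfold delta; def|]. intros e _.
    rewrite delta_def, (b2n_false (d = c)) by easy; ring.
Qed.

(** Coefficients are kept as numbers, so that [ring] proves genuine equalities; reduction modulo 2
    is left to [null]. *)
Lemma D1_semiring : semi_ring_theory cnull (delta 0) cadd conv (@eq (D N1)).
Proof.
  constructor.
  - intros f; apply fun_ext; intros n; rewrite cadd_def, cnull_def; ring.
  - intros f g; apply fun_ext; intros n; rewrite !cadd_def; ring.
  - intros f g h; apply fun_ext; intros n; rewrite !cadd_def; ring.
  - intros f; apply fun_ext; intros n.
    transitivity ((delta 0 ** f) $ (0 # n)); [f_equal; ring|apply conv_delta].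
  - intros f; apply fun_ext; intros n; rewrite conv_def, cnull_def.
    apply sum_zeroF; [def|]; intros d _; apply sum_zeroF; [def|]; intros e _.
    rewrite cnull_def; ring.
  - apply conv_comm.
  - apply conv_assoc.
  - intros f g h; apply fun_ext; intros n; rewrite cadd_def, !conv_def.
    rewrite <- sum_addF by def. apply sum_eqF; [unfold cadd; def|def|]; intros d _.
    rewrite <- sum_addF by def. apply sum_eqF; [unfold cadd; def|def|]; intros e _.
    rewrite cadd_def; ring.
Qed.

Add Ring D1_ring : D1_semiring.

Ltac def_hook ::=
  first [assumption | progress (unfold least, Even, conv, cadd, delta); def | idtac].

(** Vanishing modulo 2. Accordingly [null (f ++ g)] expresses that [f] and [g] are equal over
    F_2. *)
Definition null (f : D N1) : Prop := forall n, Even (f $ n).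

Lemma null_add f g : null f -> null g -> null (f ++ g).
Proof. intros Hf Hg n; rewrite cadd_def; now apply even_add. Qed.

Lemma null_double f : null (f ++ f).
Proof. intros n; rewrite cadd_def; apply even_double. Qed.

Lemma null_cancel f g : null f -> null (f ++ g) -> null g.
Proof.
  intros Hf H n; specialize (H n); rewrite cadd_def in H; eapply even_cancel; [apply Hf|exact H].
Qed.

Lemma odd_conv f g n : ~ Even ((f ** g) $ n) ->
  exists d e, d # e = n /\ ~ Even (f $ d) /\ ~ Even (g $ e).
Proof.
  intros H; apply NNPP; intros HN; apply H; rewrite conv_def.
  apply sum_even; intros d _; rewrite beta by def.
  apply sum_even; intros e _; rewrite beta by def.
  destruct (classic (d # e = n)) as [E|E].
  - rewrite mulC; apply even_mul.
    destruct (classic (Even (f $ d))); [now apply even_mul|].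
    rewrite mulC; apply even_mul. apply NNPP; intros Hg; apply HN; eauto.
  - rewrite b2n_false by easy; apply even_mul, even_0.
Qed.

Lemma null_mul f g : null f -> null (f ** g).
Proof.
  intros Hf n; apply NNPP; intros H; apply odd_conv in H; destruct H as (d & e & _ & H & _); auto.
Qed.

Lemma not_null_least f : ~ null f ->
  exists a, ~ Even (f $ a) /\ forall i, i < a -> Even (f $ i).
Proof.
  intros H; destruct (least_spec (fun i => ~ Even (f $ i))) as [H1 H2].
  - def.
  - apply not_all_ex_not, H.
  - eexists; split; [exact H1|]. intros i Hi; apply NNPP, H2, Hi.
Qed.

Lemma null_prime f g : null (f ** g) -> null f \/ null g.
Proof.
  intros H; apply NNPP; intros HN; apply not_or_and in HN; destruct HN as [Hf Hg].
  apply not_null_least in Hf, Hg; destruct Hf as [a [Ha Hf]], Hg as [b [Hb Hg]].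
  revert H; apply ex_not_not_all; exists (a # b); rewrite conv_def.
  assert (La : a < a # b + 1) by (apply lt_diff; exists (a * b + b); ring).
  assert (Lb : b < a # b + 1) by (apply lt_diff; exists (a * b + a); ring).
  apply sum_odd with (k := a); [easy| |].
  - rewrite beta by def. apply sum_odd with (k := b); [easy| |].
    + rewrite beta by def. rewrite b2n_true, mulC, mul1 by easy; now apply odd_mul.
    + intros e _ He; rewrite beta by def. rewrite b2n_false; [apply even_mul, even_0|].
      intros E; now apply op_cancel in E.
  - intros d _ Hd; rewrite beta by def. apply sum_even; intros e _; rewrite beta by def.
    (* A pair with [d < a] or [e < b] has an even coefficient product by minimality; if [d] exceeds
       [a] and [e] is at least [b], the product is larger than [a # b]. *)
    destruct (lt_total d a) as [E|[E|E]]; [|easy|].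
    + rewrite mulC; apply even_mul, even_mul, Hf, E.
    + destruct (lt_total e b) as [E'|[E'|E']].
      * rewrite mulC; apply even_mul; rewrite mulC; apply even_mul, Hg, E'.
      * rewrite b2n_false; [apply even_mul, even_0|]. subst e. intros E'.
        rewrite (op_comm d b), (op_comm a b) in E'. now apply op_cancel in E'.
      * rewrite b2n_false; [apply even_mul, even_0|]. intros E''.
        apply (lt_irrefl (a # b)); rewrite <- E'' at 2.
        apply lt_trans with (a # e); [now apply op_lt|].
        rewrite (op_comm a e), (op_comm d e); now apply op_lt.
Qed.

Lemma delta_not_null c : ~ null (delta c).
Proof.
  intros H; specialize (H c); rewrite delta_def, b2n_true in H by easy.
  revert H; apply odd_iff; exists 0; ring.
Qed.

(** * Gradings *)

(* P_n is the product of the first n terms of Sylvester's sequence Q_0, Q_1, ... = 2, 3, 7, ... *)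
Definition P : D N1 := rec $ Lam (fun _ : N => Lam (fun r : N => r * (r + 1))) $ 1.
Notation Q n := (P $ n + 1).

Lemma P_0 : P $ 0 = 1.
Proof. unfold P; apply rec_0. Qed.

Lemma P_S n : P $ (n + 1) = P $ n * (P $ n + 1).
Proof. unfold P; now rewrite rec_S, !beta by def. Qed.

Lemma P_pos n : exists p, P $ n = p + 1.
Proof.
  induct n; [exists 0; rewrite P_0; ring|].
  intros n [p E]; exists (p * p + p + p + p + 1); rewrite P_S, E; ring.
Qed.

Lemma Q_dvd_P n m : n < m -> exists c, P $ m = Q n * c.
Proof.
  intros H; apply lt_diff in H; destruct H as [z ->]; induct z.
  - exists (P $ n); rewrite add0, P_S; ring.
  - intros z [c E]; exists (c * Q (n + z + 1)).
    replace (n + (z + 1) + 1) with (n + z + 1 + 1) by ring.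
    rewrite P_S, E; ring.
Qed.

Definition unit_mod (q u : N) : Prop := exists x y, u * x = 1 + q * y.

Lemma unit_mod_1 q : unit_mod q 1.
Proof. exists 1, 0; ring. Qed.

Lemma unit_mod_mul q u v : unit_mod q u -> unit_mod q v -> unit_mod q (u * v).
Proof.
  intros [x [y E]] [x' [y' E']]; exists (x * x'), (y + y' + q * (y * y')).
  transitivity (u * x * (v * x')); [ring|]. rewrite E, E'; ring.
Qed.

(** The modulus is written so as to be at least 2: modulo 1 every number is a unit. *)
Lemma unit_mod_dvd p a : ~ unit_mod (p + 1 + 1) ((p + 1 + 1) * a).
Proof.
  intros [x [b E]]. rewrite <- mulA in E; set (c := a * x) in E; clearbody c; clear a x.
  destruct (classic (b < c)) as [H|H].
  - apply lt_diff in H; destruct H as [z ->].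
    assert (E' : (p + 1 + 1) * z + p + 1 = 0).
    { apply (add_cancel _ _ ((p + 1 + 1) * b + 1)). rewrite add0l.
      transitivity (1 + (p + 1 + 1) * b); [rewrite <- E; ring|ring]. }
    apply (nlt_0 0); rewrite <- E' at 2; apply lt_succ_pos.
  - apply nlt_le in H; destruct H as [z ->].
    assert (E' : (p + 1 + 1) * z + 1 = 0).
    { apply (add_cancel _ _ ((p + 1 + 1) * c)). rewrite add0l.
      transitivity (1 + (p + 1 + 1) * (c + z)); [ring|now rewrite <- E]. }
    apply (nlt_0 0); rewrite <- E' at 2; apply lt_succ_pos.
Qed.

(** For [n < m], Q_n divides Q_m - 1, so Q_m is 1 modulo Q_n. For [m < n], Q_m divides [P $ n],
    which is -1 modulo Q_n and hence its own inverse. *)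
Lemma Q_coprime n m : n <> m -> unit_mod (Q n) (Q m).
Proof.
  intros H; destruct (lt_total n m) as [L|[L|L]]; [|easy|]; apply Q_dvd_P in L; destruct L as [c E].
  - exists 1, c; rewrite E; ring.
  - destruct (P_pos n) as [p Ep]. exists (c * P $ n), p.
    transitivity (Q m * c * P $ n); [ring|]. rewrite <- E, Ep; ring.
Qed.

(** The even power q^(2n). *)
Definition pw : D (N0 ~> N0 ~> N0) :=
  Lam (fun q : N => rec $ Lam (fun _ : N => Lam (fun r : N => r * (q * q))) $ 1).

Lemma pw_0 q : pw $ q $ 0 = 1.
Proof. unfold pw; rewrite beta by def; apply rec_0. Qed.

Lemma pw_S q n : pw $ q $ (n + 1) = pw $ q $ n * (q * q).
Proof. unfold pw; rewrite beta by def; now rewrite rec_S, !beta by def. Qed.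

Lemma pw_add q n m : pw $ q $ (n + m) = pw $ q $ n * pw $ q $ m.
Proof.
  induct m; [rewrite add0, pw_0; ring|]. intros m E.
  rewrite addA, !pw_S, E; ring.
Qed.

Lemma pw_pos q n : exists p, pw $ (q + 1) $ n = p + 1.
Proof.
  induct n; [exists 0; rewrite pw_0; ring|].
  intros n [p E]; exists ((p + 1) * (q * q + q + q) + p); rewrite pw_S, E; ring.
Qed.

(** The integer [k + 1] has an even exponent at Q_n. As Q_n need not be prime, the cofactor is
    required to be a unit modulo Q_n rather than a non-multiple of it; this makes the property
    multiplicative. *)
Definition even_part (n k : N) : Prop :=
  exists j u, k + 1 = pw $ (Q n) $ j * u /\ unit_mod (Q n) u.

Lemma even_part_op n k l : even_part n k -> even_part n l -> even_part n (k # l).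
Proof.
  intros (j & u & E & Hu) (j' & u' & E' & Hu'); exists (j + j'), (u * u').
  split; [|now apply unit_mod_mul].
  transitivity ((k + 1) * (l + 1)); [ring|]. rewrite E, E', pw_add; ring.
Qed.

Lemma even_part_0 n : even_part n 0.
Proof.
  exists 0, 1; split; [rewrite pw_0; ring|apply unit_mod_1].
Qed.

Lemma even_part_neq n m : n <> m -> even_part n (P $ m).
Proof.
  intros H; exists 0, (Q m); split; [rewrite pw_0; ring|now apply Q_coprime].
Qed.

Lemma even_part_square n m : even_part n (P $ m # P $ m).
Proof.
  destruct (classic (n = m)) as [<-|H].
  - exists (0 + 1), 1; split; [|apply unit_mod_1]. rewrite pw_S, pw_0; ring.
  - apply even_part_op; now apply even_part_neq.
Qed.

(** Otherwise an odd power of Q_n times a unit would equal an even power times a unit. Cancelling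
    the common power leaves a unit modulo Q_n that is a multiple of Q_n. *)
Lemma even_part_odd n k : even_part n k -> ~ even_part n (P $ n # k).
Proof.
  intros (i & u & E & Hu) (j & v & E' & Hv).
  destruct (P_pos n) as [p Ep].
  assert (EE : Q n * (pw $ (Q n) $ i * u) = pw $ (Q n) $ j * v).
  { rewrite <- E, <- E'; ring. }
  clear k E E'. destruct (classic (j < i)) as [H|H].
  - apply lt_diff in H; destruct H as [z ->].
    replace (j + z + 1) with (j + (z + 1)) in EE by ring.
    rewrite pw_add in EE. destruct (pw_pos (P $ n) j) as [r Er]; rewrite Er in EE.
    assert (Ev : v = Q n * (pw $ (Q n) $ (z + 1) * u)).
    { apply (mul_cancel _ _ r). rewrite (mulC v), <- EE; ring. }
    rewrite Ev, Ep in Hv; now apply unit_mod_dvd in Hv.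
  - apply nlt_le in H; destruct H as [z ->].
    rewrite pw_add in EE. destruct (pw_pos (P $ n) i) as [r Er]; rewrite Er in EE.
    assert (Ev : Q n * u = pw $ (Q n) $ z * v).
    { apply (mul_cancel _ _ r). rewrite (mulC (pw $ _ $ z * v)), mulA, <- EE; ring. }
    destruct (zero_or_succ z) as [->|[w ->]].
    + rewrite pw_0 in Ev. assert (Ev' : v = Q n * u) by (rewrite Ev; ring).
      rewrite Ev', Ep in Hv; now apply unit_mod_dvd in Hv.
    + rewrite pw_S in Ev.
      assert (Eu : u = Q n * (pw $ (Q n) $ w * v)).
      { apply (mul_cancel _ _ (P $ n)). rewrite (mulC u), Ev; ring. }
      rewrite Eu, Ep in Hu; now apply unit_mod_dvd in Hu.
Qed.

Definition supp (n : N) (f : D N1) : Prop := forall k, ~ Even (f $ k) -> even_part n k.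

Lemma supp_add n f g : supp n f -> supp n g -> supp n (f ++ g).
Proof.
  intros Hf Hg k H; rewrite cadd_def in H.
  destruct (classic (Even (f $ k))) as [E|E]; [|now apply Hf].
  apply Hg; intros E'; now apply H, even_add.
Qed.

Lemma supp_mul n f g : supp n f -> supp n g -> supp n (f ** g).
Proof.
  intros Hf Hg k H; apply odd_conv in H; destruct H as (d & e & <- & Hd & He).
  apply even_part_op; auto.
Qed.

Lemma supp_delta n c : even_part n c -> supp n (delta c).
Proof.
  intros H k Hk; rewrite delta_def in Hk.
  destruct (classic (k = c)) as [->|E]; [easy|].
  rewrite b2n_false in Hk by easy; now destruct Hk; apply even_0.
Qed.

Lemma supp_cnull n : supp n cnull.
Proof. intros k []; rewrite cnull_def; apply even_0. Qed.

Lemma supp_square n c : even_part n (c # c) -> supp n (delta c ** delta c).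
Proof.
  intros H k Hk; apply odd_conv in Hk; destruct Hk as (d & e & <- & Hd & He).
  assert (E : forall i, ~ Even (delta c $ i) -> i = c).
  { intros i Hi; apply NNPP; intros Hn; apply Hi; rewrite delta_def, b2n_false by easy.
    apply even_0. }
  now rewrite (E d), (E e).
Qed.

(** In characteristic 2 the hypothesis says that the square of a + x_n b is zero, so a = x_n b. A
    point of the support of [b] then gives one of the support of [a] with an odd exponent of Q_n. *)
Lemma supp_sqrt n a b : supp n a -> supp n b ->
  null (a ** a ++ delta (P $ n) ** delta (P $ n) ** (b ** b)) -> null b.
Proof.
  intros Ha Hb H; apply NNPP; intros Hn; apply not_null_least in Hn.
  destruct Hn as [k [Hk _]]. set (x := delta (P $ n)) in H.
  assert (Hx : null (a ++ x ** b)).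
  { assert (H' : null ((a ++ x ** b) ** (a ++ x ** b))); [|now destruct (null_prime _ _ H')].
    replace ((a ++ x ** b) ** (a ++ x ** b))
      with ((a ** a ++ x ** x ** (b ** b)) ++ (a ** (x ** b) ++ a ** (x ** b))) by ring.
    apply null_add; [exact H|apply null_double]. }
  apply (even_part_odd n k); [now apply Hb|]. apply Ha; intros E.
  specialize (Hx (P $ n # k)); rewrite cadd_def in Hx.
  apply even_cancel in Hx; [|exact E]. unfold x in Hx; now rewrite conv_delta in Hx.
Qed.

(** * Coding sequences *)

(** Injective because [k] is less than the gap between the squares of [j + k] and [j + k + 1]; it is
    not onto, but needs no halving. *)
Definition pr (j k : N) : N := (j + k) * (j + k) + k.

Lemma pr_inj j k j' k' : pr j k = pr j' k' -> j = j' /\ k = k'.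
Proof.
  assert (H : forall j k j' k', j + k < j' + k' -> pr j k <> pr j' k').
  { clear j k j' k'; unfold pr; intros j k j' k' H E; apply lt_diff in H; destruct H as [z H].
    rewrite H in E.
    apply (nlt_0 0). replace (0 : N) with
      ((j + k) + j + z * (j + k) + z * (j + k) + z * z + z + z + k' + 1) at 2.
    - apply lt_succ_pos.
    - apply (add_cancel _ _ ((j + k) * (j + k) + k)). rewrite add0l.
      rewrite E at 2. ring. }
  intros E; destruct (lt_total (j + k) (j' + k')) as [L|[L|L]].
  - now apply H in E.
  - unfold pr in E; rewrite L in E.
    assert (Ek : k = k').
    { apply (add_cancel _ _ ((j' + k') * (j' + k'))). rewrite (addC k), E; ring. }
    subst k'; split; [eapply add_cancel; exact L|easy].
  - symmetry in E; now apply H in E.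
Qed.

Definition rowE : D (N1 ~> N0 ~> N1) :=
  Lam (fun z : D N1 => Lam (fun j : N => Lam (fun k : N => z $ (pr j k)))).
Definition row (z : D N1) (j : N) : D N1 := rowE $ z $ j.

(** [pr] is inverted by search. Numbers outside its range receive values that [row] never reads. *)
Definition mkE : D ((N0 ~> N1) ~> N1) :=
  Lam (fun F : D (N0 ~> N1) => Lam (fun x : N =>
    F $ (least (fun j => exists k, pr j k = x)) $ (least (fun k => exists j, pr j k = x)))).

Ltac def_hook ::=
  first [assumption | progress (unfold least, Even, conv, cadd, delta, row, pr); def | idtac].

Lemma row_mk F j : row (mkE $ F) j = F $ j.
Proof.
  apply fun_ext; intros k; unfold row, rowE. rewrite !beta by def.
  unfold mkE; rewrite !beta by def.
  destruct (least_spec (fun j' => exists k', pr j' k' = pr j k)) as [[k' E] _];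
    [def|now exists j, k|].
  destruct (least_spec (fun k' => exists j', pr j' k' = pr j k)) as [[j' E'] _];
    [def|now exists k, j|].
  apply pr_inj in E, E'; destruct E as [-> _], E' as [_ ->]; easy.
Qed.

(** The sequence a, b, w(0), w(1), and so on. The recursor only produces numbers, so the distinction
    of cases takes place at each argument [k] separately. *)
Definition tri (a b : D N1) (w : D (N0 ~> N1)) : D (N0 ~> N1) :=
  Lam (fun j : N => Lam (fun k : N =>
    rec $ Lam (fun i : N => Lam (fun _ : N =>
        rec $ Lam (fun n : N => Lam (fun _ : N => w $ n $ k)) $ (b $ k) $ i))
      $ (a $ k) $ j)).

Lemma tri_0 a b w : tri a b w $ 0 = a.
Proof. apply fun_ext; intros k; unfold tri; rewrite !beta by def; now rewrite rec_0. Qed.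

Lemma tri_1 a b w : tri a b w $ 1 = b.
Proof.
  rewrite <- (add0l 1). apply fun_ext; intros k; unfold tri; rewrite !beta by def.
  rewrite rec_S, !beta by def; now rewrite rec_0.
Qed.

Lemma tri_2 a b w n : tri a b w $ (n + 1 + 1) = w $ n.
Proof.
  apply fun_ext; intros k; unfold tri; rewrite !beta by def.
  rewrite rec_S, !beta by def; now rewrite rec_S, !beta by def.
Qed.

Definition num (z : D N1) : D N1 := row z 0.
Definition den (z : D N1) : D N1 := row z 1.
Definition wit (z : D N1) : D (N0 ~> N1) := Lam (fun n : N => row z (n + 1 + 1)).
Definition frac (a b : D N1) (w : D (N0 ~> N1)) : D N1 := mkE $ tri a b w.

Lemma num_frac a b w : num (frac a b w) = a.
Proof. unfold num, frac; now rewrite row_mk, tri_0. Qed.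

Lemma den_frac a b w : den (frac a b w) = b.
Proof. unfold den, frac; now rewrite row_mk, tri_1. Qed.

Lemma wit_frac a b w : wit (frac a b w) = w.
Proof.
  apply fun_ext; intros n; unfold wit; rewrite beta by (unfold frac; def).
  unfold frac; now rewrite row_mk, tri_2.
Qed.

(** * Fields in a model *)

Record mfield : Type := MField {
  mdom : D N2;
  mzero : D N1;
  mone : D N1;
  meqv : D (N1 ~> N1 ~> N0);
  madd : D (N1 ~> N1 ~> N1);
  mopp : D (N1 ~> N1);
  mmul : D (N1 ~> N1 ~> N1)
}.

Section FieldConditions.
Variable K : mfield.
Let zero := mzero K.
Let one := mone K.
Let eqv (x y : D N1) : Prop := meqv K $ x $ y = 1.
Let add (x y : D N1) : D N1 := madd K $ x $ y.
Let opp (x : D N1) : D N1 := mopp K $ x.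
Let mul (x y : D N1) : D N1 := mmul K $ x $ y.
Notation "'for_all' x , A" := (forall x, mdom K $ x = 1 -> A) (at level 200, x name).

Definition m_equivalence : Prop :=
  (for_all x, for_all y, meqv K $ x $ y = 0 \/ meqv K $ x $ y = 1)
  /\ (for_all x, eqv x x)
  /\ (for_all x, for_all y, (eqv x y -> eqv y x))
  /\ (for_all x, for_all y, for_all z, (eqv x y -> eqv y z -> eqv x z)).

Definition m_closed : Prop :=
  mdom K $ zero = 1 /\ mdom K $ one = 1
  /\ (for_all x, for_all y, mdom K $ (add x y) = 1)
  /\ (for_all x, mdom K $ (opp x) = 1)
  /\ (for_all x, for_all y, mdom K $ (mul x y) = 1).

Definition m_congruence : Prop :=
  (for_all x, for_all y, for_all u, for_all v,
     (eqv x y -> eqv u v -> eqv (add x u) (add y v)))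
  /\ (for_all x, for_all y, (eqv x y -> eqv (opp x) (opp y)))
  /\ (for_all x, for_all y, for_all u, for_all v,
     (eqv x y -> eqv u v -> eqv (mul x u) (mul y v))).

Definition m_field_axioms : Prop :=
  (for_all x, for_all y, for_all z, eqv (add x (add y z)) (add (add x y) z))
  /\ (for_all x, for_all y, eqv (add x y) (add y x))
  /\ (for_all x, eqv (add x zero) x)
  /\ (for_all x, eqv (add x (opp x)) zero)
  /\ (for_all x, for_all y, for_all z, eqv (mul x (mul y z)) (mul (mul x y) z))
  /\ (for_all x, for_all y, eqv (mul x y) (mul y x))
  /\ (for_all x, eqv (mul x one) x)
  /\ (for_all x, for_all y, for_all z, eqv (mul x (add y z)) (add (mul x y) (mul x z)))
  /\ ~ eqv zero one
  /\ (for_all x, (~ eqv x zero -> exists y, mdom K $ y = 1 /\ eqv (mul x y) one)).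

Definition m_is_field : Prop :=
  (forall x, mdom K $ x = 0 \/ mdom K $ x = 1) /\
  m_equivalence /\ m_closed /\ m_congruence /\ m_field_axioms.

End FieldConditions.

(** * The field of square roots *)

Section Roots.
Variable Y : D N2.

Definition p10 (f : D N1) (n : N) : D N1 :=
  rec $ (sigma N0 N0 (N0 ~> N0)%ty $
    (pi (N0 ~> N0 ~> N0)%ty N0 $ pi N0 N0) $ f) $ n.

Lemma p10_0 f n : p10 f n $ 0 = n.
Proof. apply rec_0. Qed.

Lemma p10_S f n k : p10 f n $ (k + 1) = f $ k.
Proof. unfold p10; now rewrite rec_S, sigma_eq, !pi_eq. Qed.

Definition witness (n : N) (f : D N1) : Prop := Y $ (p10 f n) = 0.

Definition inK (z : D N1) : Prop := ~ null (den z) /\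
  forall n, witness n (wit z $ n) \/ (supp n (num z) /\ supp n (den z)).

Definition keq (x y : D N1) : Prop := null (num x ** den y ++ num y ** den x).

Definition merge (w w' : D (N0 ~> N1)) : D (N0 ~> N1) := Lam (fun n : N => Lam (fun k : N =>
  b2n (witness n (w $ n)) * w $ n $ k + b2n (~ witness n (w $ n)) * w' $ n $ k)).

Ltac def_hook ::=
  first [assumption | progress (unfold least, Even, conv, cadd, delta, row, pr,
    frac, mkE, tri, merge, num, den, wit, witness, p10, keq, inK, null, supp, even_part,
    unit_mod); def | idtac].

Lemma merge_l w w' n : witness n (w $ n) -> merge w w' $ n = w $ n.
Proof.
  intros H; apply fun_ext; intros k; unfold merge; rewrite !beta by def.
  rewrite b2n_true, b2n_false by tauto; ring.
Qed.

Lemma merge_r w w' n : ~ witness n (w $ n) -> merge w w' $ n = w' $ n.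
Proof.
  intros H; apply fun_ext; intros k; unfold merge; rewrite !beta by def.
  rewrite b2n_false, b2n_true by tauto; ring.
Qed.

(** At each [n], either one of the operands carries a witness, which the merged sequence retains, or
    all four series are even in Q_n and the last hypothesis passes this on to [a] and [b]. *)
Lemma inK_merge x y a b : inK x -> inK y -> ~ null b ->
  (forall n, supp n (num x) -> supp n (den x) -> supp n (num y) -> supp n (den y) ->
     supp n a /\ supp n b) ->
  inK (frac a b (merge (wit x) (wit y))).
Proof.
  intros [_ Hx] [_ Hy] Hb H; unfold inK; rewrite num_frac, den_frac, wit_frac.
  split; [exact Hb|]. intros n.
  destruct (classic (witness n (wit x $ n))) as [Wx|Wx]; [left; now rewrite merge_l|].
  rewrite merge_r by exact Wx.
  destruct (Hy n) as [Wy|[]]; [now left|]. destruct (Hx n) as [|[]]; [easy|].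
  right; auto.
Qed.

Definition Kadd : D (N1 ~> N1 ~> N1) := Lam (fun x : D N1 => Lam (fun y : D N1 =>
  frac (num x ** den y ++ num y ** den x) (den x ** den y) (merge (wit x) (wit y)))).

Definition Kmul : D (N1 ~> N1 ~> N1) := Lam (fun x : D N1 => Lam (fun y : D N1 =>
  frac (num x ** num y) (den x ** den y) (merge (wit x) (wit y)))).

(* The witnesses do not matter when the exponents of all [Q n] are even on the support of [a]. *)
Definition Kconst (a : D N1) : D N1 := frac a (delta 0) (Lam (fun _ : N => cnull)).

(* The characteristic is 2, so that the opposite is the identity. *)
Definition K : mfield := {|
  mdom := Lam (fun z : D N1 => b2n (inK z));
  mzero := Kconst cnull;
  mone := Kconst (delta 0);
  meqv := Lam (fun x : D N1 => Lam (fun y : D N1 => b2n (keq x y)));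
  madd := Kadd;
  mopp := Lam (fun x : D N1 => x);
  mmul := Kmul |}.

Lemma K_dom z : mdom K $ z = b2n (inK z).
Proof. unfold K; simpl; now rewrite beta by def. Qed.

Lemma K_eqv x y : meqv K $ x $ y = b2n (keq x y).
Proof. unfold K; simpl; now rewrite !beta by def. Qed.

Lemma K_add x y : madd K $ x $ y =
  frac (num x ** den y ++ num y ** den x) (den x ** den y) (merge (wit x) (wit y)).
Proof. unfold K, Kadd; simpl; now rewrite !beta by def. Qed.

Lemma K_mul x y : mmul K $ x $ y =
  frac (num x ** num y) (den x ** den y) (merge (wit x) (wit y)).
Proof. unfold K, Kmul; simpl; now rewrite !beta by def. Qed.

Lemma K_opp x : mopp K $ x = x.
Proof. unfold K; simpl; now rewrite beta by def. Qed.

Lemma null_eq f g : f = g -> null (f ++ g).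
Proof. intros ->; apply null_double. Qed.

Lemma inK_const a : (forall n, supp n a) -> inK (Kconst a).
Proof.
  intros Ha; unfold Kconst, inK; rewrite num_frac, den_frac; split; [apply delta_not_null|].
  intros n; right; split; [apply Ha|apply supp_delta, even_part_0].
Qed.

Lemma den_mul_not_null x y : inK x -> inK y -> ~ null (den x ** den y).
Proof. intros [Hx _] [Hy _] H; apply null_prime in H; tauto. Qed.

Lemma K_is_field : m_is_field K.
Proof.
  assert (Hdom : forall z, mdom K $ z = 1 <-> inK z) by (intros; rewrite K_dom; apply b2n_1).
  assert (Heqv : forall x y, meqv K $ x $ y = 1 <-> keq x y)
    by (intros; rewrite K_eqv; apply b2n_1).
  split; [intros; rewrite K_dom; apply b2n_01|].
  split; [|split; [|split]].
  - unfold m_equivalence; repeat split.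
    + intros; rewrite K_eqv; apply b2n_01.
    + intros x _; apply Heqv, null_double.
    + intros x _ y _; rewrite !Heqv; unfold keq; intros H.
      now replace (num y ** den x ++ num x ** den y)
        with (num x ** den y ++ num y ** den x) by ring.
    + intros x _ y Hy z _; rewrite !Heqv; unfold keq; intros Hxy Hyz.
      (* Transitivity cancels the middle denominator, and this is where the ring has to be a
         domain. *)
      destruct (null_prime (den y) (num x ** den z ++ num z ** den x)) as [H|H]; [| |exact H].
      (* In the absence of subtraction, the term that would cancel is added twice, doubles being
         null. *)
      * apply (null_cancel (num y ** den x ** den z ++ num y ** den x ** den z));
          [apply null_double|].
        match goal with |- null ?f => replace f with
          ((num x ** den y ++ num y ** den x) ** den z ++
           (num y ** den z ++ num z ** den y) ** den x) by ring end.
        now apply null_add; apply null_mul.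
      * apply Hdom in Hy; now destruct Hy.
  - unfold m_closed; repeat split.
    + apply Hdom, inK_const, supp_cnull.
    + apply Hdom, inK_const; intros n; apply supp_delta, even_part_0.
    + intros x Hx y Hy; rewrite K_add; apply Hdom; apply Hdom in Hx, Hy.
      apply inK_merge; [easy|easy|now apply den_mul_not_null|].
      intros n; split; [apply supp_add|]; now apply supp_mul.
    + intros x Hx; now rewrite K_opp.
    + intros x Hx y Hy; rewrite K_mul; apply Hdom; apply Hdom in Hx, Hy.
      apply inK_merge; [easy|easy|now apply den_mul_not_null|].
      intros n; split; now apply supp_mul.
  - unfold m_congruence; repeat split.
    + intros x _ y _ u _ v _; rewrite !K_add, !Heqv; unfold keq; rewrite !num_frac, !den_frac.
      intros H H'.
      match goal with |- null ?f => replace f with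
        ((num x ** den y ++ num y ** den x) ** (den u ** den v) ++
         (num u ** den v ++ num v ** den u) ** (den x ** den y)) by ring end.
      now apply null_add; apply null_mul.
    + intros x _ y _; now rewrite !K_opp.
    + intros x _ y _ u _ v _; rewrite !K_mul, !Heqv; unfold keq; rewrite !num_frac, !den_frac.
      intros H H'.
      set (t := num y ** den x ** (num u ** den v)).
      apply (null_cancel (t ++ t)); [apply null_double|].
      match goal with |- null ?f => replace f with
        ((num x ** den y ++ num y ** den x) ** (num u ** den v) ++
         (num u ** den v ++ num v ** den u) ** (num y ** den x)) by (unfold t; ring) end.
      now apply null_add; apply null_mul.
  - unfold m_field_axioms.
    assert (E0 : mzero K = Kconst cnull) by easy.
    assert (E1 : mone K = Kconst (delta 0)) by easy.
    rewrite E0, E1.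
    repeat split; try intros x Hx; try intros y Hy; try intros z Hz;
      rewrite ?K_add, ?K_mul, ?K_opp, ?Heqv, ?E0, ?E1;
      unfold keq, Kconst; rewrite ?num_frac, ?den_frac; try (apply null_eq; ring).
    + match goal with |- null ?f => replace f with
        (num x ** den x ++ num x ** den x) by ring end. apply null_double.
    + intros H; apply (delta_not_null 0).
      now replace (delta 0) with (cnull ** delta 0 ++ delta 0 ** delta 0) by ring.
    + intros Hn; apply Hdom in Hx; destruct Hx as [_ Hx].
      (* The condition on supports is symmetric in numerator and denominator, so the inverse keeps
         the witnesses. *)
      exists (frac (den x) (num x) (wit x)); rewrite Hdom, K_mul, Heqv.
      unfold inK, keq; rewrite !num_frac, !den_frac, wit_frac.
      split; [split|apply null_eq; ring].
      * intros H; apply Hn.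
        now replace (num x ** delta 0 ++ cnull ** den x) with (num x) by ring.
      * intros n; destruct (Hx n); tauto.
Qed.

(* The square of the variable x_n, as an element of [K]. *)
Definition radicand : D (N0 ~> N1) :=
  Lam (fun n : N => Kconst (delta (P $ n) ** delta (P $ n))).

Lemma radicand_eq n : radicand $ n = Kconst (delta (P $ n) ** delta (P $ n)).
Proof. unfold radicand; rewrite beta by (unfold Kconst; def); easy. Qed.

Lemma radicand_in n : mdom K $ (radicand $ n) = 1.
Proof.
  rewrite K_dom, radicand_eq; apply b2n_true, inK_const.
  intros m; apply supp_square, even_part_square.
Qed.

Lemma radicand_sqrt n f : witness n f -> exists x, mdom K $ x = 1 /\
  meqv K $ (mmul K $ x $ x) $ (radicand $ n) = 1.
Proof.
  intros H; exists (frac (delta (P $ n)) (delta 0) (Lam (fun _ : N => f))).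
  rewrite K_dom, K_eqv, K_mul, radicand_eq; unfold inK, keq, Kconst.
  rewrite !num_frac, !den_frac, wit_frac; split; apply b2n_true.
  - split; [apply delta_not_null|]. intros m; rewrite beta by def.
    destruct (classic (m = n)) as [->|E]; [now left|right].
    split; apply supp_delta; [now apply even_part_neq|apply even_part_0].
  - apply null_eq; ring.
Qed.

(** If the entry of [x] at [n] is not a witness, numerator and denominator are both even in Q_n, and
    [supp_sqrt] makes the denominator vanish. *)
Lemma sqrt_witness n x : mdom K $ x = 1 ->
  meqv K $ (mmul K $ x $ x) $ (radicand $ n) = 1 -> exists f, witness n f.
Proof.
  rewrite K_dom, K_eqv, K_mul, radicand_eq, !b2n_1; unfold keq, Kconst.
  rewrite !num_frac, !den_frac; intros [Hd Hx] H.
  destruct (Hx n) as [W|[H1 H2]]; [eauto|exfalso].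
  apply Hd, (supp_sqrt n (num x)); [easy|easy|].
  now replace (num x ** num x) with (num x ** num x ** delta 0) by ring.
Qed.

End Roots.

(** * Square roots in a field *)

Section Field.
Variable L : mfield.
Hypothesis HL : m_is_field L.

(** On this type the operations are total, so [ring] applies modulo [feq]. *)
Definition carrier : Type := {x : D N1 | mdom L $ x = 1}.
Definition feq (x y : carrier) : Prop := meqv L $ proj1_sig x $ proj1_sig y = 1.

Let Hequiv : m_equivalence L := proj1 (proj2 HL).
Let Hclosed : m_closed L := proj1 (proj2 (proj2 HL)).
Let Hcongr : m_congruence L := proj1 (proj2 (proj2 (proj2 HL))).
Let Haxioms : m_field_axioms L := proj2 (proj2 (proj2 (proj2 HL))).

Definition f0 : carrier := exist _ (mzero L) (proj1 Hclosed).
Definition f1 : carrier := exist _ (mone L) (proj1 (proj2 Hclosed)).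
Definition fplus (x y : carrier) : carrier :=
  exist _ (madd L $ proj1_sig x $ proj1_sig y)
    (proj1 (proj2 (proj2 Hclosed)) _ (proj2_sig x) _ (proj2_sig y)).
Definition fneg (x : carrier) : carrier :=
  exist _ (mopp L $ proj1_sig x) (proj1 (proj2 (proj2 (proj2 Hclosed))) _ (proj2_sig x)).
Definition ftimes (x y : carrier) : carrier :=
  exist _ (mmul L $ proj1_sig x $ proj1_sig y)
    (proj2 (proj2 (proj2 (proj2 Hclosed))) _ (proj2_sig x) _ (proj2_sig y)).

Lemma feq_equiv : RelationClasses.Equivalence feq.
Proof.
  destruct Hequiv as (_ & H1 & H2 & H3).
  split; repeat intros [? ?]; unfold feq; simpl; eauto.
Qed.

Lemma field_ext : ring_eq_ext fplus ftimes fneg feq.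
Proof.
  destruct Hcongr as (H1 & H2 & H3); split.
  - intros [x ?] [y ?] E [u ?] [v ?] E'; apply H1; auto.
  - intros [x ?] [y ?] E [u ?] [v ?] E'; apply H3; auto.
  - intros [x ?] [y ?] E; apply H2; auto.
Qed.

Lemma field_ring : ring_theory f0 f1 fplus ftimes (fun x y => fplus x (fneg y)) fneg feq.
Proof.
  destruct Haxioms as (A1 & A2 & A3 & A4 & A5 & A6 & A7 & A8 & _).
  pose proof feq_equiv as E; pose proof field_ext as X.
  assert (C : forall x y, feq (ftimes x y) (ftimes y x)).
  { repeat intros [? ?]; unfold feq; simpl; auto. }
  assert (B : forall x y, feq (fplus x y) (fplus y x)).
  { repeat intros [? ?]; unfold feq; simpl; auto. }
  split; try (repeat intros [? ?]; unfold feq; simpl; auto; fail).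
  - intros x; transitivity (fplus x f0); [apply B|destruct x; unfold feq; simpl; auto].
  - intros x; transitivity (ftimes x f1); [apply C|destruct x; unfold feq; simpl; auto].
  - intros x y z; transitivity (ftimes z (fplus x y)); [apply C|].
    transitivity (fplus (ftimes z x) (ftimes z y)).
    + destruct x, y, z; unfold feq; simpl; auto.
    + apply (Radd_ext X); apply C.
  - intros x y; reflexivity.
Qed.

Add Ring field_ring : field_ring (setoid feq_equiv field_ext).

#[local] Existing Instance feq_equiv.
#[local] Instance fplus_proper :
  Morphisms.Proper (Morphisms.respectful feq (Morphisms.respectful feq feq)) fplus :=
  Radd_ext field_ext.
#[local] Instance ftimes_proper :
  Morphisms.Proper (Morphisms.respectful feq (Morphisms.respectful feq feq)) ftimes :=
  Rmul_ext field_ext.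
#[local] Instance fneg_proper :
  Morphisms.Proper (Morphisms.respectful feq feq) fneg :=
  Ropp_ext field_ext.

Lemma field_one_neq_zero : ~ feq f1 f0.
Proof.
  intros H; symmetry in H; revert H. destruct Haxioms as (_ & _ & _ & _ & _ & _ & _ & _ & H & _).
  exact H.
Qed.

Lemma field_inv x : ~ feq x f0 -> exists y, feq (ftimes x y) f1.
Proof.
  intros H; destruct Haxioms as (_ & _ & _ & _ & _ & _ & _ & _ & _ & Hi).
  destruct (Hi _ (proj2_sig x) H) as [y [Hy E]]; exists (exist _ y Hy); exact E.
Qed.

(** The product of [x - t] and [x + t] is zero; if the first factor is invertible, the second
    vanishes. *)
Lemma field_sqrt_unique x t :
  feq (ftimes x x) (ftimes t t) -> feq x t \/ feq x (fneg t).
Proof.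
  intros H; set (d := fplus x (fneg t)).
  destruct (classic (feq d f0)) as [Hd|Hd].
  - left; transitivity (fplus d t); [unfold d; ring|]. rewrite Hd; ring.
  - right; destruct (field_inv d Hd) as [y Hy].
    transitivity (fplus (ftimes (fplus x t) f1) (fneg t)); [ring|]. rewrite <- Hy.
    transitivity (fplus (ftimes y (fplus (ftimes x x) (fneg (ftimes t t)))) (fneg t)).
    + unfold d; ring.
    + rewrite H; ring.
Qed.

(* The evaluation of X^2 - c at x. *)
Lemma field_quadratic x c p0 p1 p2 q0 q1 q2 s0 s1 s2 :
  feq p0 (fneg c) -> feq p1 f0 -> feq p2 f1 ->
  feq q0 f1 -> feq q1 (ftimes q0 x) -> feq q2 (ftimes q1 x) ->
  feq s0 (ftimes p0 q0) -> feq s1 (fplus s0 (ftimes p1 q1)) ->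
  feq s2 (fplus s1 (ftimes p2 q2)) -> feq s2 f0 -> feq (ftimes x x) c.
Proof.
  intros P0 P1 P2 Q0 Q1 Q2 S0 S1 S2 S.
  transitivity (fplus c s2).
  - rewrite S2, S1, S0, Q2, Q1, Q0, P2, P1, P0; ring.
  - rewrite S; ring.
Qed.

End Field.

(** * Algebraic closure, isomorphisms and the two principles inside a model *)

Definition m_poly (K : mfield) (p : D (N0 ~> N1)) (n : N) : Prop :=
  (forall i, i < n + 1 -> mdom K $ (p $ i) = 1) /\ ~ meqv K $ (p $ n) $ mzero K = 1.

Definition m_poly_value (K : mfield) (p : D (N0 ~> N1)) (n : N) (x y : D N1) : Prop :=
  exists q s : D (N0 ~> N1),
    (forall i, i < n + 1 -> mdom K $ (q $ i) = 1 /\ mdom K $ (s $ i) = 1)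
    /\ meqv K $ (q $ 0) $ mone K = 1
    /\ (forall i, i < n -> meqv K $ (q $ (i + 1)) $ (mmul K $ (q $ i) $ x) = 1)
    /\ meqv K $ (s $ 0) $ (mmul K $ (p $ 0) $ (q $ 0)) = 1
    /\ (forall i, i < n -> meqv K $ (s $ (i + 1)) $
          (madd K $ (s $ i) $ (mmul K $ (p $ (i + 1)) $ (q $ (i + 1)))) = 1)
    /\ meqv K $ (s $ n) $ y = 1.

Definition m_alg_closed (K : mfield) : Prop := forall p n, 0 < n -> m_poly K p n ->
  exists x, mdom K $ x = 1 /\ m_poly_value K p n x (mzero K).

Lemma alg_closed_sqrt (L : mfield) (c : D N1) : m_is_field L -> m_alg_closed L ->
  mdom L $ c = 1 -> exists x, mdom L $ x = 1 /\ meqv L $ (mmul L $ x $ x) $ c = 1.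
Proof.
  intros HL Hac Hc.
  (* The coefficients of X^2 - c from the constant term upwards; the constant sequence one provides
     the leading coefficient at index 2. *)
  pose (p := tri (mopp L $ c) (mzero L) (Lam (fun _ : N => mone L))).
  assert (p0 : p $ 0 = mopp L $ c) by apply tri_0.
  assert (p1 : p $ 1 = mzero L) by apply tri_1.
  assert (p2 : p $ (1 + 1) = mone L).
  { rewrite <- (add0l 1) at 1; unfold p; rewrite tri_2; now rewrite beta by def. }
  assert (l0 : 0 < 1 + 1 + 1) by apply lt_succ_pos.
  assert (l1 : 1 < 1 + 1 + 1) by (apply lt_succ_r; left; apply lt_succ_r; now right).
  assert (l2 : 1 + 1 < 1 + 1 + 1) by (apply lt_succ_r; now right).
  assert (l3 : 0 < 1 + 1) by apply lt_succ_pos.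
  assert (l4 : 1 < 1 + 1) by (apply lt_succ_r; now right).
  pose (f0' := f0 L HL); pose (f1' := f1 L HL).
  destruct (Hac p (1 + 1)) as [x [Hx (q & s & Hqs & Q0 & Q1 & S0 & S1 & S2)]]; [easy| |].
  - split; [|rewrite p2; exact (field_one_neq_zero L HL)].
    intros i Hi; apply lt_succ_r in Hi; destruct Hi as [Hi| ->].
    + apply lt_succ_r in Hi; destruct Hi as [Hi| ->].
      * destruct (zero_or_succ i) as [->|[m ->]].
        -- rewrite p0; exact (proj2_sig (fneg L HL (exist _ c Hc))).
        -- exfalso; apply (nlt_0 m), (lt_add_iff m 0 1); now rewrite add0l.
      * rewrite p1; exact (proj2_sig f0').
    + rewrite p2; exact (proj2_sig f1').
  - exists x; split; [exact Hx|].
    pose proof (Q1 0 l3) as Q1'; pose proof (Q1 1 l4) as Q2'.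
    pose proof (S1 0 l3) as S1'; pose proof (S1 1 l4) as S2'.
    rewrite add0l in Q1', S1'.
    rewrite p0 in S0; rewrite p1 in S1'; rewrite p2 in S2'.
    pose (F := fun y (H : mdom L $ y = 1) => exist _ y H : carrier L).
    pose (q0 := F _ (proj1 (Hqs 0 l0))); pose (s0 := F _ (proj2 (Hqs 0 l0))).
    pose (q1 := F _ (proj1 (Hqs 1 l1))); pose (s1 := F _ (proj2 (Hqs 1 l1))).
    pose (q2 := F _ (proj1 (Hqs _ l2))); pose (s2 := F _ (proj2 (Hqs _ l2))).
    pose (x' := F x Hx); pose (c' := F c Hc).
    pose proof (@RelationClasses.Equivalence_Reflexive _ _ (feq_equiv L HL)) as E.
    exact (field_quadratic L HL x' c' (fneg L HL c') f0' f1' q0 q1 q2 s0 s1 s2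
      (E _) (E _) (E _) Q0 Q1' Q2' S0 S1' S2' S2).
Qed.

Definition m_restrict (K : mfield) (S : D N2) : mfield :=
  MField S (mzero K) (mone K) (meqv K) (madd K) (mopp K) (mmul K).

Definition m_subfield (K : mfield) (S : D N2) : Prop :=
  (forall x, S $ x = 1 -> mdom K $ x = 1)
  /\ (forall x, S $ x = 1 -> forall y, mdom K $ y = 1 -> meqv K $ x $ y = 1 -> S $ y = 1)
  /\ m_is_field (m_restrict K S).

Definition m_iso (K M : mfield) (h : D (N1 ~> N1)) : Prop :=
  (forall x, mdom K $ x = 1 -> mdom M $ (h $ x) = 1)
  /\ (forall x, mdom K $ x = 1 -> forall y, mdom K $ y = 1 ->
        (meqv K $ x $ y = 1 <-> meqv M $ (h $ x) $ (h $ y) = 1))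
  /\ (forall y, mdom M $ y = 1 -> exists x, mdom K $ x = 1 /\ meqv M $ (h $ x) $ y = 1)
  /\ meqv M $ (h $ mzero K) $ mzero M = 1
  /\ meqv M $ (h $ mone K) $ mone M = 1
  /\ (forall x, mdom K $ x = 1 -> forall y, mdom K $ y = 1 ->
        meqv M $ (h $ (madd K $ x $ y)) $ (madd M $ (h $ x) $ (h $ y)) = 1)
  /\ (forall x, mdom K $ x = 1 -> meqv M $ (h $ (mopp K $ x)) $ (mopp M $ (h $ x)) = 1)
  /\ (forall x, mdom K $ x = 1 -> forall y, mdom K $ y = 1 ->
        meqv M $ (h $ (mmul K $ x $ y)) $ (mmul M $ (h $ x) $ (h $ y)) = 1).

Definition m_ALCL : Prop := forall D z o e a n m, let K := MField D z o e a n m in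
  m_is_field K -> exists D' z' o' e' a' n' m', let L := MField D' z' o' e' a' n' m' in
    m_is_field L /\ m_alg_closed L /\
    exists S, m_subfield L S /\ exists h, m_iso K (m_restrict L S) h.

Lemma means_ALCL (w : @world M) : means w ALCL m_ALCL.
Proof.
  unfold ALCL, m_ALCL, all_field, ex_field, is_subfield, is_iso, is_alg_closed, is_poly,
    poly_value, restrict, m_subfield, m_iso, m_alg_closed, m_poly, m_poly_value, m_restrict,
    is_field, m_is_field, is_set, is_equivalence, is_closed, is_congruence, field_axioms,
    m_equivalence, m_closed, m_congruence, m_field_axioms;
  cbn [fdom fzero fone feqv fadd fopp fmul mdom mzero mone meqv madd mopp mmul].
  mean.
Qed.

Definition m_is_BOOT (Y : D N2) (X : D N1) : Prop :=
  (forall n, X $ n = 0 \/ X $ n = 1) /\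
  forall n, X $ n = 1 <-> exists f, Y $ (p10 f n) = 0.

Lemma means_BOOT (w : @world M) : means w BOOT (forall Y, exists X, m_is_BOOT Y X).
Proof. unfold BOOT, pair10, is_set, m_is_BOOT, p10; mean. Qed.

Lemma delta_CA (Y Z : D N2) :
  (forall n, (exists f, Y $ (p10 f n) = 0) <-> (forall g, Z $ (p10 g n) = 0)) ->
  exists X, m_is_BOOT Y X.
Proof.
  revert Y Z; apply (sat_means DeltaCA).
  - split; [now apply prv_ax; right|apply sentence_closed].
    unfold DeltaCA, pair10, is_set, mem; below.
  - unfold DeltaCA, pair10, is_set, m_is_BOOT, p10; mean.
Qed.

Theorem ALCL_BOOT : m_ALCL -> forall Y, exists X, m_is_BOOT Y X.
Proof.
  intros HALCL Y.
  destruct (HALCL _ _ _ _ _ _ _ (K_is_field Y))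
    as (D' & z' & o' & e' & a' & n' & m' & HL & Hac & S & (SL & Seq & HS) & h & Hiso).
  set (L := MField D' z' o' e' a' n' m') in *.
  change (m_iso (K Y) (m_restrict L S) h) in Hiso.
  destruct Hiso as (hS & heq & hsurj & _ & _ & _ & _ & hmul).
  set (K := K Y) in *; pose (c n := h $ (radicand $ n)).
  assert (cS : forall n, S $ (c n) = 1) by (intros n; apply hS, radicand_in).
  pose (tail (g : D N1) := Lam (fun k => g $ (k + 1))).
  pose (sq r n := meqv L $ (mmul L $ r $ r) $ (c n) = 1).
  assert (trans : forall x y z, mdom L $ x = 1 -> mdom L $ y = 1 -> mdom L $ z = 1 ->
    meqv L $ x $ y = 1 -> meqv L $ y $ z = 1 -> meqv L $ x $ z = 1).
  { intros x y z Hx Hy Hz; apply HL; easy. }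
  assert (sym : forall x y, mdom L $ x = 1 -> mdom L $ y = 1 ->
    meqv L $ x $ y = 1 -> meqv L $ y $ x = 1).
  { intros x y Hx Hy; apply HL; easy. }
  assert (Lmul : forall x y, mdom L $ x = 1 -> mdom L $ y = 1 -> mdom L $ (mmul L $ x $ y) = 1).
  { intros x y Hx Hy; apply HL; easy. }
  assert (Kmul : forall x y, mdom K $ x = 1 -> mdom K $ y = 1 -> mdom K $ (mmul K $ x $ y) = 1).
  { intros x y Hx Hy; apply (K_is_field Y); easy. }
  (* The isomorphism carries square roots of x_n^2 in [K] to square roots of [c n] in [S], and
     back. *)
  assert (Hsqrt : forall n, (exists f, Y $ (p10 f n) = 0) <-> exists r, S $ r = 1 /\ sq r n).
  { intros n; split.
    - intros [f Hf]; destruct (radicand_sqrt Y n f Hf) as (x & Hx & Hxx).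
      exists (h $ x); split; [now apply hS|].
      assert (Hrad := radicand_in Y n).
      apply (trans _ (h $ (mmul K $ x $ x))); auto.
      apply (heq (mmul K $ x $ x) (Kmul x x Hx Hx) _ Hrad), Hxx.
    - intros [r [Hr Hrr]]; destruct (hsurj r Hr) as (x & Hx & Hxr).
      apply (sqrt_witness Y n x Hx). assert (Hrad := radicand_in Y n).
      apply (heq _ (Kmul x x Hx Hx) _ Hrad).
      apply (trans _ (mmul L $ (h $ x) $ (h $ x))); auto.
      apply (trans _ (mmul L $ r $ r)); auto.
      apply HL; auto. }
  (* Any other root equals [r] or its opposite, and [S] is closed under opposites and under the
     equality of [L]. *)
  assert (Hroots : forall n r g, S $ r = 1 -> sq r n -> mdom L $ g = 1 -> sq g n -> S $ g = 1).
  { intros n r g Hr Hrr Hg Hgg.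
    assert (Hgr : meqv L $ (mmul L $ g $ g) $ (mmul L $ r $ r) = 1).
    { apply (trans _ (c n)); auto. }
    assert (Hopp : S $ (mopp L $ r) = 1) by (apply HS; exact Hr).
    destruct (field_sqrt_unique L HL (exist _ g Hg) (exist _ r (SL r Hr)) Hgr) as [H|H].
    - apply (Seq r Hr g Hg); apply sym; auto.
    - apply (Seq _ Hopp g Hg); apply sym; auto. }
  assert (Htail : forall f n, tail (p10 f n) = f).
  { intros f n; apply fun_ext; intros k; unfold tail, p10; rewrite beta by def.
    apply p10_S. }
  (* The argument codes a pair, its head being the number and its tail the candidate root. The
     negation is due to Delta-comprehension testing for the value 0. *)
  pose (Y1 := Lam (fun g : D N1 => b2n (~ (S $ tail g = 1 /\ sq (tail g) (g $ 0))))).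
  pose (Z1 := Lam (fun g : D N1 =>
    b2n (~ (mdom L $ tail g = 1 -> sq (tail g) (g $ 0) -> S $ tail g = 1)))).
  assert (HY1 : forall f n, Y1 $ (p10 f n) = 0 <-> S $ f = 1 /\ sq f n).
  { intros f n; unfold Y1; rewrite beta by (unfold sq, c, tail; def).
    rewrite Htail, p10_0, b2n_0; split; [exact (NNPP _)|tauto]. }
  assert (HZ1 : forall f n, Z1 $ (p10 f n) = 0 <-> (mdom L $ f = 1 -> sq f n -> S $ f = 1)).
  { intros f n; unfold Z1; rewrite beta by (unfold sq, c, tail; def).
    rewrite Htail, p10_0, b2n_0; split; [exact (NNPP _)|tauto]. }
  destruct (delta_CA Y1 Z1) as [X [HX01 HX]].
  - intros n; setoid_rewrite HY1; setoid_rewrite HZ1; split.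
    + intros [r [Hr Hrr]] g Hg Hgg; eauto.
    (* Algebraic closedness provides a root in [L], without which the universal form could hold
       vacuously. *)
    + intros H; destruct (alg_closed_sqrt L (c n) HL Hac (SL _ (cS n))) as [r [Hr Hrr]].
      exists r; split; [now apply H|exact Hrr].
  - exists X; split; [exact HX01|]. intros n; rewrite HX, Hsqrt.
    now setoid_rewrite HY1.
Qed.

End Model.

Theorem theorem3p31 :
  proves ACA0w_DeltaCA (sentence (bimp ALCL BOOT)).
Proof.
  apply completeness_closed; [exact ax_eq|].
  intros M HM HT e; apply (sat_sentence e _ (m_ALCL M -> forall Y, exists X, m_is_BOOT M Y X)).
  - apply means_imp; [now apply means_ALCL|now apply means_BOOT].
  - exact (ALCL_BOOT M HM HT).
Qed.
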